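(* Let $\mathfrak{V}\subseteq\mathbb{D}_Q$ be a homogeneous subvariety of a nc operator ball. Then the following are equivalent for $f\in H^\infty(\mathfrak{V})$: (1) $f$ is radially uniformly continuous. (2) $f\in A(\mathfrak{V})$. (3) $f\in U(\mathfrak{V})$, i.e. $f$ is uniformly continuous on $\mathfrak{V}$.
   Context: $M_n^d$ is the set of $d$-tuples of complex $n\times n$ matrices ($M_n=M_n^1$), with $\|X\|_\infty=\max_j\|X_j\|$; $\mathbb{M}^d=\sqcup_{n\ge1}M_n^d$; for $\Omega\subseteq\mathbb{M}^d$, $\Omega(n)=\Omega\cap M_n^d$. A nc function $f:\Omega\to\mathbb{M}^1$ on a set $\Omega$ closed under direct sums is a graded map ($X\in\Omega(n)\Rightarrow f(X)\in M_n$) with $f(X\oplus Y)=f(X)\oplus f(Y)$ and $f(S^{-1}XS)=S^{-1}f(X)S$ whenever $S\in GL_n$ and $X,S^{-1}XS\in\Omega(n)$. NC operator ball: given Hilbert spaces $\mathcal{R},\mathcal{S}$ and linearly independent $Q_1,\dots,Q_d\in\mathcal{L}(\mathcal{R},\mathcal{S})$, put $Q(X)=\sum_jQ_j\otimes X_j$ for $X\in\mathbb{M}^d$ and $\mathbb{D}_Q=\{X\in\mathbb{M}^d:\|Q(X)\|<1\}$. $H^\infty(\mathbb{D}_Q)$ is the algebra of bounded nc functions $\mathbb{D}_Q\to\mathbb{M}^1$. A subvariety of $\mathbb{D}_Q$ is a set $\mathfrak{V}=\{X\in\mathbb{D}_Q: f(X)=0\ \forall f\in S\}$ with $S\subseteq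 H^\infty(\mathbb{D}_Q)$; it is homogeneous if $\lambda\mathfrak{V}\subseteq\mathfrak{V}$ for all $\lambda\in\mathbb{C}$, $|\lambda|\le1$. $H^\infty(\mathfrak{V})$ is the algebra of bounded nc functions $\mathfrak{V}\to\mathbb{M}^1$ with norm $\|f\|=\sup_{X\in\mathfrak{V}}\|f(X)\|$; $A(\mathfrak{V})$ is the norm closure in it of the restrictions to $\mathfrak{V}$ of free nc polynomials. $f$ is uniformly continuous on $\mathfrak{V}$ if for each $\epsilon>0$ there is $\delta>0$ such that $\|f(X)-f(Y)\|<\epsilon$ for all $n$ and $X,Y\in\mathfrak{V}(n)$ with $\|X-Y\|_\infty<\delta$. $f$ is radially uniformly continuous if for each $\epsilon>0$ there is $\delta>0$ such that $\|f(rX)-f(sX)\|<\epsilon$ for all $n$, all $X\in\mathfrak{V}(n)$ and all $r,s\in(0,1)$ with $|r-s|<\delta$. *)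

(* Defs.v *)
From HB Require Import structures.
From mathcomp Require Import all_boot all_order all_algebra.
From mathcomp Require Import complex.
From mathcomp Require Import all_classical all_reals all_analysis.

Set Implicit Arguments.
Unset Strict Implicit.
Unset Printing Implicit Defensive.

Import Order.TTheory GRing.Theory Num.Theory.
Import numFieldNormedType.Exports.

Local Open Scope classical_set_scope.
Local Open Scope complex_scope.
Local Open Scope ring_scope.

(* Complex Hilbert spaces: the norm of a Banach space over R[i] is induced by a
   positive definite sesquilinear form (linear in the first variable). *)
HB.mixin Record CompleteNormedModule_isHilbert (R : realType) H
    of CompleteNormedModule R[i] H := {
  inner : {dot H for (@Num.conj R[i])} ;
  normr_inner : forall x : H, `|x| ^+ 2 = inner x x
}.

#[short(type="hilbertType")]
HB.structure Definition Hilbert (R : realType) :=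
  {H of CompleteNormedModule_isHilbert R H & CompleteNormedModule R[i] H}.

(* The norm of V^n = V (x) C^n (Hilbert space tensor product). The norm of V
   takes its values in R[i] (in its nonnegative reals), hence the real part. *)
Definition l2norm (R : realType) (V : normedZmodType R[i]) n (v : 'I_n -> V) : R :=
  Num.sqrt (\sum_(i < n) (complex.Re `|v i|) ^+ 2).

(* Used only for maps T that are bounded on the unit ball, for which the real
   supremum is the operator norm. *)
Definition l2opnorm (R : realType) (U V : normedZmodType R[i]) m n
    (T : ('I_m -> U) -> ('I_n -> V)) : R :=
  sup [set l2norm (T v) | v in [set v | l2norm v <= 1]].

(* C*-norm; the norm that the library puts on matrices is the entrywise
   maximum. *)
Definition mxopnorm (R : realType) n (A : 'M[R[i]]_n) : R :=
  l2opnorm (fun (v : 'I_n -> R[i]) (i : 'I_n) => \sum_(k < n) A i k * v k).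

(* Matrices of size 0 are excluded: level n consists of matrices of size n+1. *)
Definition nctuple (R : realType) (d n : nat) := 'I_d -> 'M[R[i]]_n.+1.

Definition ncset (R : realType) (d : nat) := forall n, set (nctuple R d n).

(* Graded maps to M^1. They are total; a nc function on V : ncset R d is
   represented by any of its extensions, and only its values on V matter. *)
Definition ncmap (R : realType) (d : nat) :=
  forall n, nctuple R d n -> 'M[R[i]]_n.+1.

Section NCTuples.
Variables (R : realType) (d : nat).
Local Notation C := R[i].

Definition tscale n (a : C) (X : nctuple R d n) : nctuple R d n :=
  fun j => a *: X j.

Definition tsub n (X Y : nctuple R d n) : nctuple R d n := fun j => X j - Y j.

Definition tnorm n (X : nctuple R d n) : R :=
  \big[Num.max/0]_(j < d) mxopnorm (X j).

(* (n + m.+1).+1 is convertible to n.+1 + m.+1. *)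
Definition mxdsum n m (A : 'M[C]_n.+1) (B : 'M[C]_m.+1) : 'M[C]_((n + m.+1).+1) :=
  block_mx A 0 0 B.

Definition tdsum n m (X : nctuple R d n) (Y : nctuple R d m) :
    nctuple R d (n + m.+1) :=
  fun j => mxdsum (X j) (Y j).

Definition tconj n (S : 'M[C]_n.+1) (X : nctuple R d n) : nctuple R d n :=
  fun j => invmx S *m X j *m S.

Definition dsum_closed (V : ncset R d) : Prop :=
  forall n m (X : nctuple R d n) (Y : nctuple R d m),
    V n X -> V m Y -> V (n + m.+1)%N (tdsum X Y).

Record nc_function (V : ncset R d) (f : ncmap R d) : Prop := {
  nc_domain : dsum_closed V ;
  nc_dsum : forall n m (X : nctuple R d n) (Y : nctuple R d m),
    V n X -> V m Y -> f (n + m.+1)%N (tdsum X Y) = mxdsum (f n X) (f m Y) ;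
  nc_similarity : forall n (X : nctuple R d n) (S : 'M[C]_n.+1),
    S \in unitmx -> V n X -> V n (tconj S X) ->
    f n (tconj S X) = invmx S *m f n X *m S
}.

Definition supnorm (V : ncset R d) (f : ncmap R d) : \bar R :=
  ereal_sup [set z | exists n (X : nctuple R d n),
                       V n X /\ z = (mxopnorm (f n X))%:E].

Definition Hinfty (V : ncset R d) : set (ncmap R d) :=
  [set f | nc_function V f /\ (supnorm V f < +oo)%E].

(* Free polynomials in d noncommuting variables, as finite sums of
   (coefficient, word); the empty word is the constant 1. *)
Definition ncpoly := seq (C * seq 'I_d).

Definition ncpoly_eval (p : ncpoly) : ncmap R d :=
  fun n X => \sum_(t <- p) t.1 *: \prod_(j <- t.2) X j.

(* The restriction of p to V lies in Hinfty V automatically: polynomials are nc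
   functions, and p differs from f by a bounded function. *)
Definition Adisc (V : ncset R d) : set (ncmap R d) :=
  [set f | Hinfty V f /\ forall e : R, 0 < e ->
     exists p : ncpoly,
       (supnorm V (fun n X => f n X - ncpoly_eval p X)%R < e%:E)%E].

Definition unif_continuous_on (V : ncset R d) (f : ncmap R d) : Prop :=
  forall e : R, 0 < e -> exists2 delta : R, 0 < delta &
    forall n (X Y : nctuple R d n), V n X -> V n Y ->
      tnorm (tsub X Y) < delta -> mxopnorm (f n X - f n Y) < e.

Definition radially_unif_continuous_on (V : ncset R d) (f : ncmap R d) : Prop :=
  forall e : R, 0 < e -> exists2 delta : R, 0 < delta &
    forall n (X : nctuple R d n) (r s : R), V n X ->
      0 < r < 1 -> 0 < s < 1 -> `|r - s| < delta ->
      mxopnorm (f n (tscale r%:C X) - f n (tscale s%:C X)) < e.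

Definition homogeneous (V : ncset R d) : Prop :=
  forall a : C, `|a| <= 1 ->
    forall n (X : nctuple R d n), V n X -> V n (tscale a X).

End NCTuples.

Section OperatorBall.
Variables (R : realType) (H K : hilbertType R) (d : nat).
Variable Q : 'I_d -> {linear H -> K}.

Definition lin_independent : Prop :=
  forall c : 'I_d -> R[i],
    (forall x : H, \sum_(j < d) c j *: Q j x = 0) -> forall j, c j = 0.

(* Q(X) = \sum_j Q_j (x) X_j, under the identifications of H (x) C^m and
   K (x) C^m with H^m and K^m, m = n.+1. *)
Definition pencil n (X : nctuple R d n) (v : 'I_n.+1 -> H) : 'I_n.+1 -> K :=
  fun i => \sum_(j < d) \sum_(k < n.+1) X j i k *: Q j (v k).

Definition ncball : ncset R d := fun n => [set X | l2opnorm (pencil X) < 1].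

Definition subvariety (V : ncset R d) : Prop :=
  exists2 S : set (ncmap R d), S `<=` Hinfty ncball &
    forall n, V n = [set X | ncball X /\ forall f, S f -> f n X = 0].

End OperatorBall.

(* Main.v *)
Require Import Defs.
From mathcomp Require Import all_boot all_order all_algebra.
From mathcomp Require Import complex.
From mathcomp Require Import all_classical all_reals all_analysis.
From mathcomp Require Import ring lra.

(* Boundedness of a nc function f at a triangular tuple Z = [[X, Xk - kY], [0, Y]],
   which is similar to X (+) Y, gives |f(X) k - k f(Y)| <= |f|; and a zero set V of
   nc functions contains Z as soon as it contains X and Y and the ball contains Z.
   With Y = s X this gives f(s X) -> f(X) as s -> 1 for X in V.

   For (1) => (2), let J be the nilpotent Jordan block of size m + 1 and take for k
   the column (1, t, ..., t^m): the triangular tuple built on X (x) J and t X stays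
   in the ball even when its corner is amplified by (1 - t) / t^(m+1), so that
   f(t X) is within M t^(m+1) / (1 - t) of the combination of the entries of
   f(X (x) J) given by k. The same estimate, applied to the functions defining V as
   t -> 0, shows that X (x) J belongs to V. On nilpotent points of V, f is a
   polynomial, because such points are quotients of one universal nilpotent point
   of V, namely multiplication by the coordinates on words modulo the relations of
   V. Hence f(t X) is uniformly approximated by polynomials, and radial uniform
   continuity lets t -> 1.

   For (2) => (3) => (1), linear independence of the Q_j makes the ball bounded in
   the norm of M^d, uniformly in the matrix size: the rows r for which
   sum_k r_k X_k is bounded form a subspace which contains (<Q_k x, y>)_k. *)

Set Implicit Arguments.
Unset Strict Implicit.
Unset Printing Implicit Defensive.

Import Order.TTheory GRing.Theory Num.Theory.
Import numFieldNormedType.Exports.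

Local Open Scope classical_set_scope.
Local Open Scope ring_scope.

(** * Norms on tuples of vectors and bounds on matrices *)

Section L2Norm.
Variables (R : realType) (U : normedZmodType R[i]).
Implicit Types (x y : U).

Definition rnorm x : R := complex.Re `|x|.

Lemma normr_rnorm x : `|x| = (rnorm x)%:C%C.
Proof. by rewrite RRe_real// normr_real. Qed.

Lemma rnorm_ge0 x : 0 <= rnorm x.
Proof. by rewrite -lecR -normr_rnorm normr_ge0. Qed.

Lemma rnorm0 : rnorm (0 : U) = 0.
Proof. by rewrite /rnorm normr0. Qed.

Lemma rnorm_eq0 x : rnorm x = 0 -> x = 0.
Proof. by move=> x0; apply/eqP; rewrite -normr_eq0 normr_rnorm x0. Qed.

Lemma ler_rnormD x y : rnorm (x + y) <= rnorm x + rnorm y.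
Proof. by rewrite -lecR rmorphD/= -!normr_rnorm ler_normD. Qed.

Lemma l2norm_ge0 n (u : 'I_n -> U) : 0 <= l2norm u.
Proof. exact: sqrtr_ge0. Qed.

Lemma sqr_l2norm n (u : 'I_n -> U) :
  l2norm u ^+ 2 = \sum_(i < n) rnorm (u i) ^+ 2.
Proof. by rewrite sqr_sqrtr// sumr_ge0// => i _; exact: sqr_ge0. Qed.

Lemma eq_l2norm n (u v : 'I_n -> U) : u =1 v -> l2norm u = l2norm v.
Proof.
by move=> uv; congr Num.sqrt; apply: eq_bigr => i _; rewrite uv.
Qed.

Lemma l2norm0 n : l2norm (fun _ : 'I_n => 0 : U) = 0.
Proof.
apply/eqP; rewrite -sqrf_eq0 sqr_l2norm big1// => i _.
by rewrite rnorm0 expr0n.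
Qed.

Lemma l2norm_eq0 n (u : 'I_n -> U) : l2norm u = 0 -> forall i, u i = 0.
Proof.
move=> u0 i; apply: rnorm_eq0; apply/eqP; rewrite -sqrf_eq0.
have /eqP := sqr_l2norm u; rewrite u0 expr0n/= eq_sym psumr_eq0; last first.
  by move=> j _; exact: sqr_ge0.
by move=> /allP/(_ i); rewrite mem_index_enum; apply.
Qed.

Lemma rnorm_le_l2norm n (u : 'I_n -> U) i : rnorm (u i) <= l2norm u.
Proof.
rewrite -(@ler_pXn2r _ 2)// ?nnegrE ?rnorm_ge0 ?l2norm_ge0// sqr_l2norm.
by rewrite (bigD1 i)//= lerDl sumr_ge0// => j _; exact: sqr_ge0.
Qed.

(* Coordinatewise, [(x + y)^2 <= (1 + s) x^2 + (1 + 1/s) y^2]; take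
   [s = b / a] with [a], [b] the norms of [u] and [v]. *)
Lemma ler_l2normD n (u v : 'I_n -> U) :
  l2norm (fun i => u i + v i) <= l2norm u + l2norm v.
Proof.
have [a0|a0] := eqVneq (l2norm u) 0.
  rewrite (eq_l2norm (v := v)) ?lerDr ?l2norm_ge0// => i.
  by rewrite (l2norm_eq0 a0) add0r.
have [b0|b0] := eqVneq (l2norm v) 0.
  rewrite (eq_l2norm (v := u)) ?lerDl ?l2norm_ge0// => i.
  by rewrite (l2norm_eq0 b0) addr0.
have {a0}a0 : 0 < l2norm u by rewrite lt_neqAle eq_sym a0 l2norm_ge0.
have {b0}b0 : 0 < l2norm v by rewrite lt_neqAle eq_sym b0 l2norm_ge0.
set a := l2norm u in a0 *; set b := l2norm v in b0 *.
rewrite -(@ler_pXn2r _ 2)// ?nnegrE ?addr_ge0 ?l2norm_ge0//.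
have -> : (a + b) ^+ 2 = (1 + b / a) * a ^+ 2 + (1 + a / b) * b ^+ 2.
  by field; rewrite !gt_eqF.
have ea : a ^+ 2 = \sum_(i < n) rnorm (u i) ^+ 2 by exact: sqr_l2norm.
have eb : b ^+ 2 = \sum_(i < n) rnorm (v i) ^+ 2 by exact: sqr_l2norm.
rewrite ea eb sqr_l2norm !mulr_sumr -big_split/=; apply: ler_sum => i _.
apply: (@le_trans _ _ ((rnorm (u i) + rnorm (v i)) ^+ 2)).
  by rewrite ler_pXn2r// ?nnegrE ?addr_ge0 ?rnorm_ge0// ler_rnormD.
set x := rnorm (u i); set y := rnorm (v i).
rewrite -subr_ge0.
have -> : (1 + b / a) * x ^+ 2 + (1 + a / b) * y ^+ 2 - (x + y) ^+ 2
   = (b * x - a * y) ^+ 2 / (a * b) by field; rewrite !gt_eqF.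
by rewrite divr_ge0 ?sqr_ge0// mulr_ge0 ?l2norm_ge0.
Qed.

Lemma ler_l2norm_sum (I : Type) (s : seq I) n (u : I -> 'I_n -> U) :
  l2norm (fun i => \sum_(k <- s) u k i) <= \sum_(k <- s) l2norm (u k).
Proof.
elim: s => [|k s IHs].
  rewrite big_nil -(l2norm0 n) le_eqVlt; apply/orP; left.
  by apply/eqP/eq_l2norm => i; rewrite big_nil.
rewrite big_cons; apply: le_trans (lerD (lexx _) IHs).
rewrite (eq_l2norm (v := fun i => u k i + \sum_(l <- s) u l i)) ?ler_l2normD//.
by move=> i; rewrite big_cons.
Qed.

Lemma sqr_l2norm_split p q (u : 'I_(p + q) -> U) :
  l2norm u ^+ 2 = l2norm (u \o lshift q) ^+ 2 + l2norm (u \o @rshift p q) ^+ 2.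
Proof. by rewrite !sqr_l2norm big_split_ord. Qed.

End L2Norm.

(** Norm estimates are proved on squares, where the contributions of orthogonal blocks add up. *)
Lemma l2norm_homo (R : realType) (U W : normedZmodType R[i]) n m
    (u : 'I_n -> U) (v : 'I_m -> W) (c : R) : 0 <= c ->
  (l2norm u <= c * l2norm v) = (l2norm u ^+ 2 <= c ^+ 2 * l2norm v ^+ 2).
Proof.
by move=> c0; rewrite -exprMn ler_pXn2r// nnegrE ?mulr_ge0 ?l2norm_ge0.
Qed.

Lemma rnormZ (R : realType) (U : normedModType R[i]) (a : R[i]) (x : U) :
  rnorm (a *: x) = rnorm a * rnorm x.
Proof. by rewrite /rnorm normrZ !normr_rnorm -rmorphM. Qed.

Lemma l2normZ (R : realType) (U : normedModType R[i]) (a : R[i]) n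
    (u : 'I_n -> U) :
  l2norm (fun i => a *: u i) = rnorm a * l2norm u.
Proof.
apply/eqP; rewrite -(@eqrXn2 _ 2)// ?mulr_ge0 ?rnorm_ge0 ?l2norm_ge0//.
rewrite exprMn !sqr_l2norm mulr_sumr; apply/eqP; apply: eq_bigr => i _.
by rewrite rnormZ exprMn.
Qed.

Lemma l2norm_scaler (R : realType) (U : normedModType R[i]) n
    (v : 'I_n -> R[i]^o) (x : U) :
  l2norm (fun i => v i *: x) = l2norm v * rnorm x.
Proof.
apply/eqP; rewrite -(@eqrXn2 _ 2)// ?mulr_ge0 ?rnorm_ge0 ?l2norm_ge0//.
rewrite exprMn !sqr_l2norm mulr_suml; apply/eqP; apply: eq_bigr => i _.
by rewrite rnormZ exprMn.
Qed.

(** * Scalar matrices acting on tuples of vectors *)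

Section MatrixAction.
Variables (R : realType) (U : normedModType R[i]).
Local Notation C := R[i].

(** The ampliation of [A] to tuples over [U]: with [U] the scalars it gives operator norms, with [H]
    or [K] it acts on the arguments and values of the pencil. *)
Definition mxact p q (A : 'M[C]_(p, q)) (v : 'I_q -> U) : 'I_p -> U :=
  fun i => \sum_(k < q) A i k *: v k.

Lemma mxactM p q r (A : 'M[C]_(p, q)) (B : 'M[C]_(q, r)) v :
  mxact (A *m B) v =1 mxact A (mxact B v).
Proof.
move=> i; rewrite /mxact.
under eq_bigr do rewrite mxE scaler_suml.
rewrite exchange_big; apply: eq_bigr => j _; rewrite scaler_sumr.
by apply: eq_bigr => k _; rewrite scalerA.
Qed.

Lemma mxact1 n (v : 'I_n -> U) : mxact 1%:M v =1 v.
Proof.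
move=> i; rewrite /mxact (bigD1 i)//= mxE eqxx scale1r big1 ?addr0// => k ki.
by rewrite mxE eq_sym (negPf ki) scale0r.
Qed.

Lemma mxact0 p q (v : 'I_q -> U) : mxact (0 : 'M[C]_(p, q)) v =1 (fun _ => 0).
Proof. by move=> i; rewrite /mxact big1// => k _; rewrite mxE scale0r. Qed.

Lemma mxact_row_mx p q r (A : 'M[C]_(p, q)) (B : 'M[C]_(p, r)) v :
  mxact (row_mx A B) v =1
    fun i => mxact A (v \o lshift r) i + mxact B (v \o @rshift q r) i.
Proof.
by move=> i; rewrite /mxact big_split_ord; congr (_ + _);
  apply: eq_bigr => k _; rewrite ?row_mxEl ?row_mxEr.
Qed.

Lemma mxact_col_mx p q r (A : 'M[C]_(p, r)) (B : 'M[C]_(q, r)) v :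
  (mxact (col_mx A B) v \o lshift q =1 mxact A v) *
  (mxact (col_mx A B) v \o @rshift p q =1 mxact B v).
Proof. by split=> i /=; apply: eq_bigr => k _; rewrite ?col_mxEu ?col_mxEd. Qed.

End MatrixAction.

(** * Operator norm bounds for rectangular matrices *)

Section OpBound.
Variable R : realType.
Local Notation C := R[i].

Definition opbound p q (A : 'M[C]_(p, q)) (c : R) : Prop :=
  forall v : 'I_q -> C^o, l2norm (mxact A v) <= c * l2norm v.

Lemma opboundM p q r (A : 'M[C]_(p, q)) (B : 'M[C]_(q, r)) a b :
  0 <= a -> opbound A a -> opbound B b -> opbound (A *m B) (a * b).
Proof.
move=> a0 hA hB v; rewrite (eq_l2norm (mxactM A B v)).
by rewrite (le_trans (hA _))// -mulrA ler_wpM2l.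
Qed.

Lemma opboundD p q (A B : 'M[C]_(p, q)) a b :
  opbound A a -> opbound B b -> opbound (A + B) (a + b).
Proof.
move=> hA hB v; rewrite mulrDl (le_trans _ (lerD (hA v) (hB v)))//.
rewrite (le_trans _ (ler_l2normD _ _))// le_eqVlt; apply/orP; left.
apply/eqP/eq_l2norm => i; rewrite -big_split/=.
by apply: eq_bigr => k _; rewrite mxE scalerDl.
Qed.

Lemma opboundZ p q (A : 'M[C]_(p, q)) (x : C) a :
  opbound A a -> opbound (x *: A) (rnorm x * a).
Proof.
move=> hA v.
rewrite (eq_l2norm (v := fun i => x *: mxact A v i)) => [|i].
  by rewrite l2normZ -mulrA ler_wpM2l ?rnorm_ge0.
by rewrite /mxact scaler_sumr; apply: eq_bigr => k _; rewrite mxE scalerA.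
Qed.

Lemma opbound_le p q (A : 'M[C]_(p, q)) a b :
  a <= b -> opbound A a -> opbound A b.
Proof. by move=> ab hA v; rewrite (le_trans (hA v))// ler_wpM2r ?l2norm_ge0. Qed.

Lemma opbound0 p q : opbound (0 : 'M[C]_(p, q)) 0.
Proof.
by move=> v; rewrite mul0r (eq_l2norm (mxact0 _)) l2norm0.
Qed.

Lemma opbound1 n : opbound (1%:M : 'M[C]_n) 1.
Proof. by move=> v; rewrite mul1r (eq_l2norm (mxact1 v)). Qed.

Lemma opboundN p q (A : 'M[C]_(p, q)) a : opbound A a -> opbound (- A) a.
Proof.
by move=> /(opboundZ (-1)); rewrite scaleN1r /rnorm normrN1 mul1r.
Qed.

Lemma opbound_sum (I : Type) (s : seq I) p q (A : I -> 'M[C]_(p, q)) a :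
  (forall i, opbound (A i) (a i)) ->
  opbound (\sum_(i <- s) A i) (\sum_(i <- s) a i).
Proof.
move=> hA; elim/big_rec2 : _ => [|i x y _]; first exact: opbound0.
exact: opboundD.
Qed.

Lemma opbound_row_mx0 p q r (A : 'M[C]_(p, q)) a :
  0 <= a -> opbound A a -> opbound (row_mx A (0 : 'M[C]_(p, r))) a.
Proof.
move=> a0 hA v; rewrite (eq_l2norm (v := mxact A (v \o lshift r))); last first.
  by move=> i; rewrite mxact_row_mx mxact0 addr0.
rewrite (le_trans (hA _))// ler_wpM2l//.
rewrite -(@ler_pXn2r _ 2)// ?nnegrE ?l2norm_ge0//.
by rewrite [leRHS]sqr_l2norm_split lerDl sqr_ge0.
Qed.

Lemma opbound_col0_mx p q r (A : 'M[C]_(q, r)) a :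
  opbound A a -> opbound (col_mx (0 : 'M[C]_(p, r)) A) a.
Proof.
move=> hA v; apply: le_trans (hA v).
rewrite -(@ler_pXn2r _ 2)// ?nnegrE ?l2norm_ge0//.
rewrite sqr_l2norm_split !(eq_l2norm (fst (mxact_col_mx _ _ _))).
rewrite !(eq_l2norm (snd (mxact_col_mx _ _ _))).
by rewrite (eq_l2norm (mxact0 _)) l2norm0 expr0n add0r.
Qed.

Lemma opbound_col_mx p q r (A : 'M[C]_(p, r)) (B : 'M[C]_(q, r)) a b :
  0 <= a -> 0 <= b -> opbound A a -> opbound B b -> opbound (col_mx A B) (a + b).
Proof.
move=> a0 b0 hA hB v.
rewrite l2norm_homo ?addr_ge0// sqr_l2norm_split.
rewrite !(eq_l2norm (fst (mxact_col_mx _ _ _))) !(eq_l2norm (snd (mxact_col_mx _ _ _))).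
apply: (@le_trans _ _ (a ^+ 2 * l2norm v ^+ 2 + b ^+ 2 * l2norm v ^+ 2)).
  by apply: lerD; rewrite -l2norm_homo.
rewrite -mulrDl ler_wpM2r ?sqr_ge0// sqrrD -addrA lerD2l lerDr.
by rewrite mulrn_wge0 ?mulr_ge0.
Qed.

Lemma opbound_eq0 p q (A : 'M[C]_(p, q)) : opbound A 0 -> A = 0.
Proof.
move=> hA; apply/matrixP => i j; rewrite mxE.
pose e (k : 'I_q) : C^o := (k == j)%:R.
have /l2norm_eq0/(_ i) : l2norm (mxact A e) = 0.
  by apply/eqP; rewrite eq_le l2norm_ge0 -(mul0r (l2norm e)) hA.
rewrite /mxact (bigD1 j)//= /e eqxx [_ *: _]mulr1 big1 ?addr0// => k kj.
by rewrite (negPf kj) scaler0.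
Qed.

(** Each matrix unit is a contraction, so the entries give a crude bound; it ensures that the real
    supremum in [mxopnorm] is the true norm. *)
Lemma opbound_ex p q (A : 'M[C]_(p, q)) : exists2 c, 0 <= c & opbound A c.
Proof.
exists (\sum_(i < p) \sum_(k < q) rnorm (A i k)).
  by rewrite !sumr_ge0// => i _; rewrite sumr_ge0// => k _; exact: rnorm_ge0.
rewrite [A in opbound A](matrix_sum_delta A).
apply: opbound_sum => i; apply: opbound_sum => k.
rewrite -[rnorm _]mulr1; apply: opboundZ => v; rewrite mul1r.
apply: le_trans (rnorm_le_l2norm v k) => //.
rewrite -(@ler_pXn2r _ 2)// ?nnegrE ?l2norm_ge0 ?rnorm_ge0//.
rewrite sqr_l2norm (bigD1 i)//= big1 ?addr0 => [|l li].
  rewrite /mxact (bigD1 k)//= mxE !eqxx scale1r big1 ?addr0// => l lk.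
  by rewrite mxE (negPf lk) andbF scale0r.
rewrite /mxact big1 ?rnorm0 ?expr0n// => m _.
by rewrite mxE (negPf li) scale0r.
Qed.

Lemma mxopnormE n (A : 'M[C]_n) : mxopnorm A = l2opnorm (@mxact R C^o n n A).
Proof. by []. Qed.

Lemma mxopnorm_le n (A : 'M[C]_n) c : 0 <= c -> opbound A c -> mxopnorm A <= c.
Proof.
move=> c0 hA; rewrite mxopnormE; apply: ge_sup.
  by exists (l2norm (mxact A (fun _ => 0 : C^o))), (fun _ => 0) => //=; rewrite l2norm0.
by move=> _ [v /= v1 <-]; rewrite (le_trans (hA v))// ler_piMr.
Qed.

End OpBound.

(* The real supremum defining [l2opnorm] is only meaningful once some bound is
   known; homogeneity then extends it from the unit ball. *)
Lemma l2opnorm_bound (R : realType) (U W : normedModType R[i]) m n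
    (T : ('I_m -> U) -> ('I_n -> W)) c :
  (forall a v, T (fun i => a *: v i) =1 fun i => a *: T v i) ->
  (forall v, l2norm (T v) <= c * l2norm v) ->
  0 <= c -> forall v, l2norm (T v) <= l2opnorm T * l2norm v.
Proof.
move=> TZ hT c0 v; have [v0|v0] := eqVneq (l2norm v) 0.
  by rewrite v0 mulr0; have := hT v; rewrite v0 mulr0.
have {}v0 : 0 < l2norm v by rewrite lt_neqAle eq_sym v0 l2norm_ge0.
rewrite -ler_pdivrMr//.
pose a : R[i] := (l2norm v)^-1%:C%C.
have ra : rnorm a = (l2norm v)^-1.
  by rewrite /rnorm normc_def/= expr0n addr0 sqrtr_sqr ger0_norm// invr_ge0 ltW.
have -> : l2norm (T v) / l2norm v = l2norm (T (fun i => a *: v i)).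
  by rewrite (eq_l2norm (TZ _ _)) l2normZ ra mulrC.
apply: sup_upper_bound.
  split; first by exists (l2norm (T (fun _ => 0))), (fun _ => 0) => //=; rewrite l2norm0.
  exists c => _ [w /= w1 <-]; rewrite (le_trans (hT w))// ler_piMr//.
by exists (fun i => a *: v i) => //=; rewrite l2normZ ra mulVf// gt_eqF.
Qed.

Lemma opbound_mxopnorm (R : realType) n (A : 'M[R[i]]_n) : opbound A (mxopnorm A).
Proof.
have [c c0 hA] := opbound_ex A.
apply: (@l2opnorm_bound _ R[i]^o R[i]^o _ _ (mxact A) c) => // a v i.
rewrite /mxact scaler_sumr; apply: eq_bigr => k _.
by rewrite !scalerA mulrC.
Qed.

(** * The pencil and the ball *)

Section Pencil.
Variables (R : realType) (H K : hilbertType R) (d : nat).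
Variable Q : 'I_d -> {linear H -> K}.
Hypothesis Q_bounded : forall j, continuous (Q j).
Local Notation C := R[i].

(** The pencil for rectangular blocks, so that block tuples can be split. *)
Definition rpencil p q (X : 'I_d -> 'M[C]_(p, q)) (v : 'I_q -> H) : 'I_p -> K :=
  fun i => \sum_(j < d) \sum_(k < q) X j i k *: Q j (v k).

Lemma coefZ j a x : Q j (a *: x) = a *: Q j x.
Proof. by rewrite linearZ. Qed.

Lemma pencilE n (X : nctuple R d n) : pencil Q X = rpencil X.
Proof. by []. Qed.

Lemma rpencil_block p1 p2 q1 q2 (A : 'I_d -> 'M[C]_(p1, q1))
    (B : 'I_d -> 'M[C]_(p1, q2)) (D : 'I_d -> 'M[C]_(p2, q1))
    (E : 'I_d -> 'M[C]_(p2, q2)) v :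
  (rpencil (fun j => block_mx (A j) (B j) (D j) (E j)) v \o lshift p2 =1
     fun i => rpencil A (v \o lshift q2) i + rpencil B (v \o @rshift q1 q2) i) *
  (rpencil (fun j => block_mx (A j) (B j) (D j) (E j)) v \o @rshift p1 p2 =1
     fun i => rpencil D (v \o lshift q2) i + rpencil E (v \o @rshift q1 q2) i).
Proof.
split=> i; rewrite /rpencil /= -big_split/=; apply: eq_bigr => j _;
  rewrite big_split_ord; congr (_ + _); apply: eq_bigr => k _;
  by rewrite ?block_mxEul ?block_mxEur ?block_mxEdl ?block_mxEdr.
Qed.

Lemma sqr_l2norm_rpencil_block p1 p2 q1 q2 (A : 'I_d -> 'M[C]_(p1, q1))
    (B : 'I_d -> 'M[C]_(p1, q2)) (D : 'I_d -> 'M[C]_(p2, q1))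
    (E : 'I_d -> 'M[C]_(p2, q2)) v :
  l2norm (rpencil (fun j => block_mx (A j) (B j) (D j) (E j)) v) ^+ 2 =
  l2norm (fun i => rpencil A (v \o lshift q2) i +
                   rpencil B (v \o @rshift q1 q2) i) ^+ 2 +
  l2norm (fun i => rpencil D (v \o lshift q2) i +
                   rpencil E (v \o @rshift q1 q2) i) ^+ 2.
Proof.
rewrite sqr_l2norm_split (eq_l2norm (fst (rpencil_block _ _ _ _ _))).
by rewrite (eq_l2norm (snd (rpencil_block _ _ _ _ _))).
Qed.

Lemma rpencil0 p q (v : 'I_q -> H) :
  rpencil (fun _ => 0 : 'M[C]_(p, q)) v =1 (fun _ => 0).
Proof.
move=> i; rewrite /rpencil big1// => j _; rewrite big1// => k _.
by rewrite mxE scale0r.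
Qed.

Lemma l2norm_rpencilD0 p q r (X : 'I_d -> 'M[C]_(p, q)) v (w : 'I_r -> H) :
  (l2norm (fun i => rpencil X v i + rpencil (fun _ => 0) w i) =
     l2norm (rpencil X v)) *
  (l2norm (fun i => rpencil (fun _ => 0) w i + rpencil X v i) =
     l2norm (rpencil X v)).
Proof. by split; apply: eq_l2norm => i; rewrite rpencil0 ?addr0 ?add0r. Qed.

(** Scalar matrices act on the other tensor factor, hence commute with each [Q j]. *)
Lemma rpencil_mulr p q r (X : 'I_d -> 'M[C]_(p, q)) (A : 'M[C]_(q, r)) v :
  rpencil (fun j => X j *m A) v =1 rpencil X (mxact A v).
Proof.
move=> i; apply: eq_bigr => j _.
under eq_bigr do rewrite mxE scaler_suml.
rewrite exchange_big; apply: eq_bigr => l _; rewrite linear_sum scaler_sumr.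
by apply: eq_bigr => k _; rewrite coefZ scalerA.
Qed.

Lemma rpencil_mull p q r (X : 'I_d -> 'M[C]_(q, r)) (A : 'M[C]_(p, q)) v :
  rpencil (fun j => A *m X j) v =1 mxact A (rpencil X v).
Proof.
move=> i; rewrite /mxact /rpencil.
under [RHS]eq_bigr do rewrite scaler_sumr.
rewrite [RHS]exchange_big; apply: eq_bigr => j _.
under [LHS]eq_bigr do rewrite mxE scaler_suml.
under [RHS]eq_bigr do rewrite scaler_sumr.
rewrite [LHS]exchange_big; apply: eq_bigr => l _.
by apply: eq_bigr => k _; rewrite scalerA.
Qed.

Lemma rpencilZ p q (X : 'I_d -> 'M[C]_(p, q)) a v :
  rpencil (fun j => a *: X j) v =1 fun i => a *: rpencil X v i.
Proof.
move=> i; rewrite scaler_sumr; apply: eq_bigr => j _; rewrite scaler_sumr.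
by apply: eq_bigr => k _; rewrite mxE scalerA.
Qed.

Lemma rpencil_linear p q (X : 'I_d -> 'M[C]_(p, q)) a u v :
  rpencil X (fun i => u i + a *: v i) =1
    fun i => rpencil X u i + a *: rpencil X v i.
Proof.
move=> i; rewrite /rpencil scaler_sumr -big_split/=; apply: eq_bigr => j _.
rewrite scaler_sumr -big_split/=; apply: eq_bigr => k _.
by rewrite linearD coefZ scalerDr !scalerA mulrC.
Qed.

Lemma rpencil_scale p q (X : 'I_d -> 'M[C]_(p, q)) a v :
  rpencil X (fun i => a *: v i) =1 fun i => a *: rpencil X v i.
Proof.
move=> i; rewrite scaler_sumr; apply: eq_bigr => j _; rewrite scaler_sumr.
by apply: eq_bigr => k _; rewrite coefZ !scalerA mulrC.
Qed.

Lemma bounded_coef j :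
  exists2 r : R, 0 <= r & forall x, rnorm (Q j x) <= r * rnorm x.
Proof.
have /continuous_linear_bounded/linear_boundedP : {for 0, continuous (Q j)}.
  by have := @Q_bounded j 0.
move=> /pinfty_ex_gt0[r r0 hr]; exists (complex.Re r).
  by rewrite -lecR RRe_real ?gtr0_real// ltW.
move=> x; rewrite -lecR rmorphM/= (RRe_real (gtr0_real r0)).
by rewrite -!normr_rnorm.
Qed.

Lemma rpencil_bounded p q (X : 'I_d -> 'M[C]_(p, q)) :
  exists2 c, 0 <= c & forall v, l2norm (rpencil X v) <= c * l2norm v.
Proof.
have /choice[r hr] : forall j, exists r : R,
    0 <= r /\ forall x, rnorm (Q j x) <= r * rnorm x.
  by move=> j; have [r] := bounded_coef j; exists r.
pose c j k := l2norm (fun i => X j i k : C^o) * r j.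
have c0 j k : 0 <= c j k by rewrite mulr_ge0 ?l2norm_ge0//; case: (hr j).
exists (\sum_(j < d) \sum_(k < q) c j k).
  by rewrite !sumr_ge0// => j _; rewrite sumr_ge0.
move=> v.
apply: le_trans (ler_l2norm_sum _ (fun j i => \sum_(k < q) X j i k *: Q j (v k))) _.
rewrite mulr_suml; apply: ler_sum => j _.
apply: le_trans (ler_l2norm_sum _ (fun k i => X j i k *: Q j (v k))) _.
rewrite mulr_suml; apply: ler_sum => k _.
rewrite (l2norm_scaler (fun i => X j i k) (Q j (v k))).
rewrite -mulrA ler_wpM2l ?l2norm_ge0//; case: (hr j) => rj0 /(_ (v k)) h.
by rewrite (le_trans h)// ler_wpM2l// rnorm_le_l2norm.
Qed.

(** Continuity of the [Q j] makes the supremum a true operator norm; its gap to 1 is the room in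
    which corners are added. *)
Lemma ncballP n (X : nctuple R d n) : ncball Q X ->
  exists rho : R, [/\ 0 <= rho, rho < 1 &
    forall v, l2norm (pencil Q X v) ^+ 2 <= rho ^+ 2 * l2norm v ^+ 2].
Proof.
have [c c0 hc] := rpencil_bounded X.
have hX := l2opnorm_bound (rpencil_scale X) hc c0.
move=> X1; exists (l2opnorm (rpencil X)).
have r0 : 0 <= l2opnorm (rpencil X).
  apply: le_trans (l2norm_ge0 (rpencil X (fun _ => 0))) _.
  apply: ub_le_sup; last by exists (fun _ => 0) => //=; rewrite l2norm0.
  by exists c => _ [v /= v1 <-]; rewrite (le_trans (hc v))// ler_piMr.
by split=> // v; rewrite -l2norm_homo// hX.
Qed.

Lemma ncballI n (X : nctuple R d n) (rho : R) : 0 <= rho -> rho < 1 ->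
  (forall v, l2norm (pencil Q X v) ^+ 2 <= rho ^+ 2 * l2norm v ^+ 2) ->
  ncball Q X.
Proof.
move=> r0 r1 hX; apply: le_lt_trans r1; apply: ge_sup.
  by exists (l2norm (pencil Q X (fun _ => 0))), (fun _ => 0) => //=; rewrite l2norm0.
move=> _ [v /= v1 <-]; apply: (@le_trans _ _ (rho * l2norm v)).
  by rewrite l2norm_homo.
by rewrite ler_piMr.
Qed.

Lemma ncball0 n : ncball Q (fun _ : 'I_d => 0 : 'M[C]_n.+1).
Proof.
apply: (@ncballI _ _ 0) => // v.
by rewrite pencilE (eq_l2norm (rpencil0 _)) l2norm0 expr0n mul0r.
Qed.

Lemma ncball_absorbing n (X : nctuple R d n) :
  exists2 t : R, 0 < t <= 1 & ncball Q (tscale t%:C%C X).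
Proof.
have [c c0 hX] := rpencil_bounded X.
have [t [t0 t1 tc]] : exists t : R, [/\ 0 < t, t <= 1 & t * c < 1].
  have c1 : 0 < c + 1 by rewrite ltr_wpDl.
  exists (c + 1)^-1; rewrite invr_gt0 c1 invf_le1// lerDr c0.
  by split=> //; rewrite mulrC ltr_pdivrMr// mul1r ltrDl.
exists t; first by rewrite t0.
have tc0 : 0 <= t * c by rewrite mulr_ge0// ltW.
apply: (ncballI tc0 tc) => v.
rewrite pencilE (eq_l2norm (rpencilZ _ _ _)) l2normZ.
rewrite /rnorm normc_def/= expr0n addr0 sqrtr_sqr ger0_norm ?(ltW t0)//.
rewrite !exprMn -[leRHS]mulrA ler_pM2l ?exprn_gt0// -exprMn.
by apply: lerXn2r; rewrite ?nnegrE ?mulr_ge0 ?l2norm_ge0.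
Qed.

End Pencil.

(** * Nc functions at triangular and nilpotent points *)

Section NCFunctions.
Variables (R : realType) (d : nat).
Local Notation C := R[i].

Lemma mul_unipotent n m (k l : 'M[C]_(n, m)) :
  block_mx 1%:M k 0 1%:M *m block_mx 1%:M l 0 1%:M =
  block_mx 1%:M (l + k) 0 1%:M :> 'M[C]_(n + m).
Proof. by rewrite mulmx_block !mulmx1 !mul1mx !mulmx0 !addr0 mul0mx add0r. Qed.

Lemma unipotent_unit n m (k : 'M[C]_(n, m)) :
  (block_mx 1%:M k 0 1%:M : 'M[C]_(n + m)) \in unitmx.
Proof.
have := mul_unipotent k (- k); rewrite addNr -scalar_mx_block => h.
by case: (mulmx1_unit h).
Qed.

Lemma invmx_unipotent n m (k : 'M[C]_(n, m)) :
  invmx (block_mx 1%:M k 0 1%:M : 'M[C]_(n + m)) = block_mx 1%:M (- k) 0 1%:M.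
Proof.
have h := mul_unipotent k (- k); rewrite addNr -scalar_mx_block in h.
by rewrite -[LHS]mulmx1 -h mulKmx// unipotent_unit.
Qed.

(** The corner is the one produced by conjugating the direct sum with the unipotent matrix of corner
    [k]. *)
Definition ttri n m (X : nctuple R d n) (Y : nctuple R d m)
    (k : 'M[C]_(n.+1, m.+1)) : nctuple R d (n + m.+1) :=
  fun j => block_mx (X j) (X j *m k - k *m Y j) 0 (Y j).

Lemma conj_unipotent n m (A : 'M[C]_n) (B : 'M[C]_m) k :
  invmx (block_mx 1%:M k 0 1%:M : 'M[C]_(n + m)) *m block_mx A 0 0 B *m
    block_mx 1%:M k 0 1%:M = block_mx A (A *m k - k *m B) 0 B.
Proof.
rewrite invmx_unipotent !mulmx_block.
by rewrite !(mulmx0, mul0mx, mulmx1, mul1mx, addr0, add0r, mulNmx).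
Qed.

Lemma ttri_conj n m (X : nctuple R d n) (Y : nctuple R d m) k :
  ttri X Y k = tconj (block_mx 1%:M k 0 1%:M : 'M[C]_(n.+1 + m.+1)) (tdsum X Y).
Proof. by apply/funext => j; rewrite /ttri /tconj /tdsum -conj_unipotent. Qed.

Lemma nc_ttri (V : ncset R d) (f : ncmap R d) n m (X : nctuple R d n)
    (Y : nctuple R d m) k :
  nc_function V f -> V n X -> V m Y -> V (n + m.+1)%N (ttri X Y k) ->
  f _ (ttri X Y k) = block_mx (f _ X) (f _ X *m k - k *m f _ Y) 0 (f _ Y).
Proof.
move=> f_nc VX VY; rewrite ttri_conj => VZ.
have VS := nc_domain f_nc VX VY.
rewrite (nc_similarity f_nc (unipotent_unit k) VS VZ) (nc_dsum f_nc)//.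
exact: (conj_unipotent (f _ X) (f _ Y) k).
Qed.

(** When [T] intertwines, the triangular tuple is the direct sum itself, so the corner that
    [nc_ttri] computes must be 0. *)
Lemma nc_intertwine (V : ncset R d) (f : ncmap R d) n m (X : nctuple R d n)
    (Y : nctuple R d m)
    (T : 'M[C]_(n.+1, m.+1)) :
  nc_function V f -> V n X -> V m Y -> (forall j, X j *m T = T *m Y j) ->
  f _ X *m T = T *m f _ Y.
Proof.
move=> f_nc VX VY XTY.
have VZ := nc_domain f_nc VX VY.
have e : ttri X Y T = tdsum X Y.
  by apply/funext => j; rewrite /ttri XTY subrr.
have := nc_ttri (k := T) f_nc VX VY.
rewrite e (nc_dsum f_nc)// => /(_ VZ) fZ.
have [_ /esym/eqP] := @eq_block_mx _ n.+1 m.+1 n.+1 m.+1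
  (f _ X) 0 0 (f _ Y) (f _ X) (f _ X *m T - T *m f _ Y) 0 (f _ Y) fZ.
by rewrite subr_eq0 => /eqP.
Qed.

Lemma Hinfty_bounded (V : ncset R d) (f : ncmap R d) : Hinfty V f ->
  exists2 M : R, 0 <= M & forall n (X : nctuple R d n), V n X -> opbound (f n X) M.
Proof.
(* The maximum with 0 gives a nonnegative bound even when [V] is empty and the supremum is [-oo]. *)
move=> [_ f_fin]; exists (Num.max 0 (fine (supnorm V f))).
  by rewrite le_max lexx.
move=> n X VX; apply: opbound_le (opbound_mxopnorm _).
have : ((mxopnorm (f n X))%:E <= supnorm V f)%E.
  by apply: ereal_sup_ubound; exists n, X.
case: (supnorm V f) f_fin => [r _|//|_ //].
by rewrite lee_fin le_max => ->; rewrite orbT.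
Qed.

(** The product is a compression of the block matrix by two contractions. The factor [P] allows the
    first block row alone to be extracted. *)
Lemma opbound_corner n m p (A : 'M[C]_n) (B : 'M[C]_(n, m)) (D : 'M[C]_m)
    (P : 'M[C]_(p, n)) M : 0 <= M ->
  opbound (block_mx A B 0 D) M -> opbound P 1 -> opbound (P *m B) M.
Proof.
move=> M0 hM hP.
have -> : P *m B = row_mx P 0 *m (block_mx A B 0 D *m col_mx 0 1%:M).
  by rewrite mul_block_col !mulmx0 mulmx1 add0r mul_row_col mul0mx addr0.
rewrite -[M]mul1r; apply: opboundM => //.
  exact: (opbound_row_mx0 ler01 hP).
rewrite -[M]mulr1; apply: opboundM => //.
apply: opbound_col0_mx; exact: opbound1.
Qed.

Definition tword n (X : nctuple R d n) (w : seq 'I_d) : 'M[C]_n.+1 :=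
  \prod_(j <- w) X j.

Lemma tword_cons n (X : nctuple R d n) j w : tword X (j :: w) = X j *m tword X w.
Proof. by rewrite /tword big_cons. Qed.

Lemma tword_rcons n (X : nctuple R d n) w j : tword X (rcons w j) = tword X w *m X j.
Proof. by rewrite /tword -cats1 big_cat big_seq1. Qed.

End NCFunctions.

(* [tnilp X m] is [X (x) J], [J] the nilpotent Jordan block of size [m.+1],
   built by peeling off the first block row and column. *)
Section NilpotentAmplification.
Variables (R : realType) (d n : nat) (X : nctuple R d n).
Local Notation C := R[i].

Fixpoint nilp_size m : nat :=
  if m is m'.+1 then (n + (nilp_size m').+1)%N else n.

Fixpoint fst_block m : 'M[C]_(n.+1, (nilp_size m).+1) :=
  match m with
  | 0 => 1%:M
  | m'.+1 => (row_mx 1%:M 0 : 'M[C]_(n.+1, n.+1 + (nilp_size m').+1))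
  end.

Fixpoint tnilp m : nctuple R d (nilp_size m) :=
  match m return nctuple R d (nilp_size m) with
  | 0 => fun=> 0
  | m'.+1 => fun j =>
    (block_mx 0 (X j *m fst_block m') 0 (tnilp m' j) :
       'M[C]_(n.+1 + (nilp_size m').+1))
  end.

Fixpoint last_block m : 'M[C]_((nilp_size m).+1, n.+1) :=
  match m with
  | 0 => 1%:M
  | m'.+1 => (col_mx 0 (last_block m') : 'M[C]_(n.+1 + (nilp_size m').+1, n.+1))
  end.

(** The block column 1, t, ..., t^m, each entry times the identity of size [n.+1]. *)
Fixpoint geom_col (t : C) m : 'M[C]_((nilp_size m).+1, n.+1) :=
  match m with
  | 0 => 1%:M
  | m'.+1 =>
    (col_mx 1%:M (t *: geom_col t m') : 'M[C]_(n.+1 + (nilp_size m').+1, n.+1))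
  end.

Fixpoint geom_diag (t : C) m : 'M[C]_((nilp_size m).+1) :=
  match m with
  | 0 => 1%:M
  | m'.+1 => (block_mx 1%:M 0 0 (t *: geom_diag t m') :
                'M[C]_(n.+1 + (nilp_size m').+1))
  end.

Local Notation sz m := (nilp_size m).+1.
Let mx01 := (@mulmx0 C, @mul0mx C, @mulmx1 C, @mul1mx C).
(** Sizes are fixed here because those of the nilpotent tuples are sums only up to conversion. *)
Let row_col m p q := @mul_row_col C p n.+1 (sz m) q.
Let row_block m p := @mul_row_block C p n.+1 (sz m) n.+1 (sz m).
Let block_col m p := @mul_block_col C n.+1 (sz m) n.+1 (sz m) p.
Let col_mul m p q := @mul_col_mx C n.+1 (sz m) p q.
Let block_block m := @mulmx_block C n.+1 (sz m) n.+1 (sz m) n.+1 (sz m).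

Lemma fst_block_geom_col t m : fst_block m *m geom_col t m = 1%:M.
Proof. by case: m => [|m] /=; rewrite ?mulmx1// row_col mulmx1 mul0mx addr0. Qed.

Lemma fst_block_geom_diag t m : fst_block m *m geom_diag t m = fst_block m.
Proof.
case: m => [|m] /=; first by rewrite mulmx1.
by rewrite row_block !mx01 !addr0.
Qed.

Lemma geom_diag_col s t m : geom_diag s m *m geom_col t m = geom_col (s * t) m.
Proof.
elim: m => [|m IHm] /=; first by rewrite mulmx1.
rewrite block_col !mx01 addr0 add0r.
by rewrite -scalemxAl -scalemxAr IHm scalerA.
Qed.

Lemma opbound_fst_block m : opbound (fst_block m) 1.
Proof.
case: m => [|m]; first exact: opbound1.
exact: (@opbound_row_mx0 R n.+1 n.+1 (sz m) 1%:M 1 ler01 (@opbound1 R _)).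
Qed.

(** The shift sends (1, t, ..., t^m) to (t, ..., t^m, 0): an eigenvector for t, up to the entry
    t^(m+1) in the last block. *)
Lemma tnilp_geom_col t m j :
  tnilp m j *m geom_col t m =
  geom_col t m *m (t *: X j) - last_block m *m (t ^+ m.+1 *: X j).
Proof.
elim: m => [|m IHm] /=; first by rewrite !mx01 subrr.
have e (A B : 'M[C]_n.+1) (D E : 'M[C]_(sz m, n.+1)) :
    col_mx A D - col_mx B E = col_mx (A - B) (D - E).
  by rewrite opp_col_mx add_col_mx.
rewrite block_col !col_mul !mx01 [RHS]e subr0 !add0r.
apply: (f_equal2 (@col_mx C n.+1 (sz m) n.+1)).
  by rewrite -scalemxAr -mulmxA fst_block_geom_col mulmx1.
rewrite -scalemxAr IHm scalerBr -!scalemxAr -!scalemxAl.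
by rewrite !scalerA -exprS.
Qed.

(** Conjugating by diag(1, t, ..., t^m) rescales the Jordan block by t; this later undoes a
    dilation. *)
Lemma tnilp_geom_diag t m j :
  tnilp m j *m geom_diag t m = geom_diag t m *m (t *: tnilp m j).
Proof.
elim: m => [|m IHm] /=; first by rewrite scaler0 !mx01.
have e A B D E : t *: @block_mx C n.+1 (sz m) n.+1 (sz m) A B D E =
    block_mx (t *: A) (t *: B) (t *: D) (t *: E) by rewrite scale_block_mx.
rewrite -scalemxAr !block_block !mx01 !addr0 !add0r [RHS]e !scaler0.
apply: (f_equal2 (fun B E => @block_mx C n.+1 (sz m) n.+1 (sz m) 0 B 0 E)).
  by rewrite -scalemxAr -mulmxA fst_block_geom_diag.
by rewrite -scalemxAr -scalemxAl IHm -scalemxAr.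
Qed.

(** Dropping the first block intertwines order [m.+1] with order [m], which drives the inductions
    below. *)
Definition tail_block m : 'M[C]_(sz m, sz m.+1) :=
  (row_mx 0 1%:M : 'M[C]_(sz m, n.+1 + sz m)).

Lemma tail_block_tnilp m j : tail_block m *m tnilp m.+1 j = tnilp m j *m tail_block m.
Proof.
have e (A : 'M[C]_(sz m)) :
  A *m @row_mx C (sz m) n.+1 (sz m) 0 1%:M = row_mx (A *m 0) (A *m 1%:M).
  by rewrite mul_mx_row.
by rewrite /tail_block /= row_block [RHS]e !mx01 !add0r.
Qed.

Lemma fst_block_tnilp m j :
  fst_block m.+1 *m tnilp m.+1 j = X j *m fst_block m *m tail_block m.
Proof.
have e (A : 'M[C]_(n.+1, sz m)) :
  A *m @row_mx C (sz m) n.+1 (sz m) 0 1%:M = row_mx (A *m 0) (A *m 1%:M).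
  by rewrite mul_mx_row.
by rewrite /tail_block /= row_block [RHS]e !mx01 !addr0.
Qed.

Lemma tail_block_geom_col t m : tail_block m *m geom_col t m.+1 = t *: geom_col t m.
Proof. by rewrite /tail_block /= row_col !mx01 add0r. Qed.

Lemma tail_block_tword m w :
  tail_block m *m tword (tnilp m.+1) w = tword (tnilp m) w *m tail_block m.
Proof.
elim: w => [|j w IHw]; first by rewrite /tword !big_nil mulmx1 mul1mx.
by rewrite !tword_cons mulmxA tail_block_tnilp -!mulmxA IHw.
Qed.

(** Each letter factors through [tail_block], which lowers the order by one. *)
Lemma tword_tnilp_eq0 m w : (m < size w)%N -> tword (tnilp m) w = 0.
Proof.
elim: m w => [|m IHm] [|j w]//; first by rewrite tword_cons mul0mx.
rewrite ltnS => mw; rewrite tword_cons.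
have -> : tnilp m.+1 j =
    (col_mx (X j *m fst_block m) (tnilp m j) : 'M[C]_(n.+1 + sz m, _)) *m
    tail_block m.
  have e (A : 'M[C]_(n.+1, sz m)) B :
      col_mx A B *m @row_mx C (sz m) n.+1 (sz m) 0 1%:M =
      block_mx (A *m 0) (A *m 1%:M) (B *m 0) (B *m 1%:M).
    by rewrite mul_col_row.
  by rewrite /tail_block [RHS]e !mx01.
by rewrite -mulmxA tail_block_tword (IHm _ mw) mul0mx mulmx0.
Qed.

(** The word evaluates to X^w (x) J^|w|, and the first row of J^|w| picks the entry t^|w| of the
    geometric column, which exists as |w| <= m. *)
Lemma fst_block_tword_geom_col t m w : (size w <= m)%N ->
  fst_block m *m tword (tnilp m) w *m geom_col t m = t ^+ size w *: tword X w.
Proof.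
elim: w m => [|j w IHw] m.
  by move=> _; rewrite /tword !big_nil mulmx1 fst_block_geom_col expr0 scale1r.
case: m => // m; rewrite ltnS => wm; rewrite !tword_cons mulmxA.
rewrite fst_block_tnilp -!mulmxA [tail_block _ *m _]mulmxA tail_block_tword -mulmxA.
rewrite tail_block_geom_col -!scalemxAr exprS -scalerA; congr (_ *: _).
by have := IHw m wm; rewrite -mulmxA => ->; rewrite scalemxAr.
Qed.

End NilpotentAmplification.

(** * Closure properties of subvarieties *)

Lemma rnormC (R : realType) (t : R) : 0 <= t -> rnorm (t%:C%C : R[i]^o) = t.
Proof. by move=> t0; rewrite /rnorm normc_def/= expr0n addr0 sqrtr_sqr ger0_norm. Qed.

Lemma le0_of_le_mul (R : realType) (x D : R) : 0 <= D ->
  (forall t, 0 < t <= 2^-1 -> x <= D * t) -> x <= 0.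
Proof.
move=> D0 hx; rewrite leNgt; apply/negP => x0.
have D1 : 0 < 2 * (D + 1) by rewrite mulr_gt0// ltr_wpDl.
(* This choice gives [D * t <= D * x / (2 * (D + 1)) < x]. *)
have := hx (Num.min 2^-1 (x / (2 * (D + 1)))).
rewrite lt_min invr_gt0 ltr0n divr_gt0// ge_min lexx => /(_ isT).
rewrite leNgt => /negP; apply.
apply: (@le_lt_trans _ _ (D * (x / (2 * (D + 1))))).
  by rewrite ler_wpM2l// ge_min lexx orbT.
rewrite mulrA ltr_pdivrMr//; nra.
Qed.

(** * Matrix polynomials given by pairing with the geometric column *)

Section GeomCol.
Variables (R : realType) (n : nat).

Lemma opbound_geom_col m : exists2 B : R, 0 <= B &
  forall t : R, 0 < t <= 1 -> opbound (geom_col n t%:C%C m) B.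
Proof.
elim: m => [|m [B B0 hB]]; first by exists 1 => // t _; exact: opbound1.
exists (1 + B) => [|t t01]; first exact: addr_ge0.
apply: (@opbound_col_mx R n.+1 (nilp_size n m).+1) => //; first exact: opbound1.
apply: opbound_le (opboundZ _ (hB _ t01)); case/andP: t01 => t0 t1.
by rewrite (rnormC (ltW t0)) ler_piMl.
Qed.

Lemma opbound_linear_eq0 p q (A : 'M[R[i]]_(p, q)) (D : R) : 0 <= D ->
  (forall t, 0 < t <= 2^-1 -> opbound A (D * t)) -> A = 0.
Proof.
move=> D0 hA; apply: opbound_eq0 => v; rewrite mul0r.
apply: (@le0_of_le_mul _ _ (D * l2norm v)) => [|t /hA/(_ v)].
  by rewrite mulr_ge0 ?l2norm_ge0.
by rewrite mulrAC.
Qed.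

(* The blocks of [A] are the coefficients of the matrix polynomial
   [A *m geom_col t] of degree at most [m], which is [O(t ^ (m + 1))]. *)
Lemma geom_col_eq0 m p (A : 'M[R[i]]_(p, (nilp_size n m).+1)) (D : R) : 0 <= D ->
  (forall t : R, 0 < t <= 2^-1 -> opbound (A *m geom_col n t%:C%C m) (D * t ^+ m.+1)) ->
  A = 0.
Proof.
move=> D0; elim: m A => [|m IHm] A hA.
  by apply: (opbound_linear_eq0 D0) => t /hA; rewrite mulmx1 expr1.
have [B B0 hB] := opbound_geom_col m.
pose A0 := @lsubmx _ p n.+1 (nilp_size n m).+1 A.
pose A1 := @rsubmx _ p n.+1 (nilp_size n m).+1 A.
have [c c0 hc] := opbound_ex A1.
have A01 : A = row_mx A0 A1 by rewrite /A0 /A1 hsubmxK.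
have AE t : A *m geom_col n t m.+1 = A0 + t *: (A1 *m geom_col n t m).
  rewrite {1}A01 /= (@mul_row_col _ p n.+1 (nilp_size n m).+1) mulmx1.
  by rewrite -scalemxAr.
(* The constant coefficient is O(t), as the rest is t times a bounded term. Dividing by t then
   leaves the hypothesis at degree [m]. *)
have A00 : A0 = 0.
  apply: (@opbound_linear_eq0 _ _ _ (D + c * B)) => [|t t01].
    by rewrite addr_ge0 ?mulr_ge0.
  have /andP[t0 t1] : 0 < t <= 1.
    by case/andP: t01 => -> /le_trans ->//; rewrite invf_le1 ?ler1n.
  have -> : A0 = A *m geom_col n t%:C%C m.+1 - t%:C%C *: (A1 *m geom_col n t%:C%C m).
    by rewrite AE addrK.
  have h1 := hA t t01.
  have h2 : opbound (t%:C%C *: (A1 *m geom_col n t%:C%C m)) (t * (c * B)).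
    rewrite -[X in X * _](rnormC (ltW t0)); apply: opboundZ.
    by apply: opboundM => //; apply: hB; rewrite t0.
  apply: opbound_le (opboundD h1 (opboundN h2)).
  rewrite mulrDl [t * _]mulrC lerD2r ler_wpM2l// exprS ler_piMr ?(ltW t0)//.
  by rewrite exprn_ile1 ?(ltW t0).
have A10 : A1 = 0.
  apply: IHm => t t01; have /andP[t0 _] := t01.
  have := opboundZ (t^-1)%:C%C (hA t t01).
  rewrite AE A00 add0r scalerA -rmorphM mulVf ?gt_eqF// scale1r.
  rewrite (rnormC (t := t^-1)) ?invr_ge0 ?(ltW t0)//.
  by rewrite [in X in opbound _ X]exprS [D * _]mulrCA mulKf// gt_eqF.
by rewrite A01 A00 A10 row_mx0.
Qed.

End GeomCol.

(** * Triangular and nilpotent points of the ball and of subvarieties *)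

Section Subvariety.
Variables (R : realType) (H K : hilbertType R) (d : nat).
Variable Q : 'I_d -> {linear H -> K}.
Hypothesis Q_bounded : forall j, continuous (Q j).
Local Notation C := R[i].

(** The induction carries an input [x] in the last block and a slack on the first block of [v]. The
    slack at order [m] pays for the new row [X], and the new first block, which is never read,
    supplies the next slack. *)
Lemma sqr_l2norm_tnilp n (X : nctuple R d n) (rho : R) :
  (forall v, l2norm (pencil Q X v) ^+ 2 <= rho ^+ 2 * l2norm v ^+ 2) ->
  forall m v x,
  l2norm (fun i => rpencil Q (tnilp X m) v i + mxact (last_block R n m) x i) ^+ 2 +
    rho ^+ 2 * l2norm (mxact (fst_block R n m) v) ^+ 2 <=
  rho ^+ 2 * l2norm v ^+ 2 + l2norm x ^+ 2.
Proof.
move=> hX; elim=> [|m IHm] v x.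
  rewrite (eq_l2norm (v := x)) => [|i]; last by rewrite rpencil0 add0r mxact1.
  by rewrite (eq_l2norm (mxact1 _)) addrC.
pose w : 'I_(n.+1 + (nilp_size n m).+1) -> H := v.
pose v1 : 'I_n.+1 -> H := v \o @lshift n.+1 (nilp_size n m).+1.
pose v2 : 'I_(nilp_size n m).+1 -> H := v \o @rshift n.+1 (nilp_size n m).+1.
rewrite (@sqr_l2norm_split _ _ n.+1 (nilp_size n m).+1 v) -/v1 -/v2.
have -> : l2norm (mxact (fst_block R n m.+1) v) = l2norm v1.
  apply: eq_l2norm => i.
  rewrite [LHS](@mxact_row_mx _ _ _ n.+1 (nilp_size n m).+1) mxact0 addr0.
  by rewrite mxact1.
rewrite (@sqr_l2norm_split _ _ n.+1 (nilp_size n m).+1).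
rewrite (eq_l2norm (v := rpencil Q X (mxact (fst_block R n m) v2))) => [|i]; last first.
  apply: etrans (f_equal2 +%R (fst (rpencil_block Q (fun=> 0)
    (fun j => X j *m fst_block R n m) (fun=> 0) (tnilp X m) w) i)
    (fst (mxact_col_mx (0 : 'M[C]_n.+1) (last_block R n m) x) i)) _.
  by rewrite rpencil0 mxact0 addr0 add0r rpencil_mulr.
rewrite (eq_l2norm (v := fun i => rpencil Q (tnilp X m) v2 i +
    mxact (last_block R n m) x i)) => [|i]; last first.
  apply: etrans (f_equal2 +%R (snd (rpencil_block Q (fun=> 0)
    (fun j => X j *m fst_block R n m) (fun=> 0) (tnilp X m) w) i)
    (snd (mxact_col_mx (0 : 'M[C]_n.+1) (last_block R n m) x) i)) _.
  by rewrite rpencil0 add0r.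
have := IHm v2 x; have := hX (mxact (fst_block R n m) v2).
rewrite pencilE; lra.
Qed.

Lemma ncball_tnilp n (X : nctuple R d n) m : ncball Q X -> ncball Q (tnilp X m).
Proof.
move=> /(ncballP Q_bounded)[r [r0 r1 hr]]; apply: (ncballI r0 r1) => v.
have := sqr_l2norm_tnilp hr (m := m) v (fun _ => 0); rewrite l2norm0 expr0n addr0.
rewrite (eq_l2norm (v := rpencil Q (tnilp X m) v)) => [|i]; last first.
  by rewrite /mxact big1 ?addr0// => k _; rewrite scaler0.
by apply: le_trans; rewrite lerDl mulr_ge0 ?sqr_ge0.
Qed.

Lemma ncball_scale n (X : nctuple R d n) (t : R) : 0 <= t <= 1 -> ncball Q X ->
  ncball Q (tscale t%:C%C X).
Proof.
move=> /andP[t0 t1] /(ncballP Q_bounded)[r [r0 r1 hr]]; apply: (ncballI r0 r1) => v.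
rewrite pencilE (eq_l2norm (rpencilZ _ _ _ _)) l2normZ rnormC// exprMn.
apply: le_trans (hr v); rewrite ler_piMl ?sqr_ge0//.
by rewrite expr_le1.
Qed.

(** By [tnilp_geom_col] this factor turns the corner into [1 - t] times [X], placed in the last
    block. *)
Definition geom_intertwiner n m (t : R) : 'M[C]_((nilp_size n m).+1, n.+1) :=
  - ((1 - t) / t ^+ m.+1)%:C%C *: geom_col n t%:C%C m.

(* [(1 - t)^2 + t^2 <= 1] leaves room for the corner [(1 - t) X]. *)
Lemma ncball_ttri_tnilp n (X : nctuple R d n) m (t : R) : 0 < t < 1 ->
  ncball Q X -> ncball Q (ttri (tnilp X m) (tscale t%:C%C X) (geom_intertwiner n m t)).
Proof.
move=> /andP[t0 t1] /(ncballP Q_bounded)[r [r0 r1 hr]].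
apply: (ncballI r0 r1) => v.
have -> : ttri (tnilp X m) (tscale t%:C%C X) (geom_intertwiner n m t) =
    fun j => block_mx (tnilp X m j) (last_block R n m *m ((1 - t)%:C%C *: X j)) 0
      (t%:C%C *: X j).
  apply/funext => j; rewrite /ttri /geom_intertwiner.
  apply: (f_equal (fun B => @block_mx C (nilp_size n m).+1 n.+1
    (nilp_size n m).+1 n.+1 (tnilp X m j) B 0 (t%:C%C *: X j))).
  rewrite -scalemxAr -scalemxAl -scalerBr tnilp_geom_col addrAC subrr add0r.
  rewrite scalerN scaleNr opprK -!scalemxAr scalerA; congr (_ *: _).
  by rewrite -rmorphXn -rmorphM divfK// expf_neq0 ?gt_eqF.
pose v1 : 'I_(nilp_size n m).+1 -> H := v \o @lshift (nilp_size n m).+1 n.+1.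
pose v2 : 'I_n.+1 -> H := v \o @rshift (nilp_size n m).+1 n.+1.
rewrite pencilE (sqr_l2norm_rpencil_block Q (tnilp X m)
  (fun j => last_block R n m *m ((1 - t)%:C%C *: X j)) (fun=> 0) (fun j => t%:C%C *: X j)).
rewrite !l2norm_rpencilD0 (@sqr_l2norm_split _ _ (nilp_size n m).+1 n.+1 v) -/v1 -/v2.
pose x i := (1 - t)%:C%C *: rpencil Q X v2 i.
rewrite (eq_l2norm (v := fun i => rpencil Q (tnilp X m) v1 i +
    mxact (last_block R n m) x i)) => [|i]; last first.
  rewrite rpencil_mull; congr (_ + _); apply: eq_bigr => k _.
  by rewrite rpencilZ.
rewrite (eq_l2norm (rpencilZ _ _ _ _)) l2normZ rnormC ?(ltW t0)//.
have := sqr_l2norm_tnilp hr (m := m) v1 x.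
have -> : l2norm x = (1 - t) * l2norm (rpencil Q X v2).
  by rewrite l2normZ rnormC// subr_ge0 ltW.
have := hr v2; rewrite pencilE.
set a := l2norm (rpencil Q X v2); set b := l2norm _ ^+ 2; set e := l2norm v2 ^+ 2.
have : 0 <= r ^+ 2 * l2norm (mxact (fst_block R n m) v1) ^+ 2.
  by rewrite mulr_ge0 ?sqr_ge0.
have : ((1 - t) * a) ^+ 2 + (t * a) ^+ 2 <= a ^+ 2.
  have : 0 <= t * (1 - t) * a ^+ 2.
    by apply: mulr_ge0 (sqr_ge0 a); apply: mulr_ge0; lra.
  nra.
rewrite mulrDr; lra.
Qed.

(** With this scalar [k] the corner is [eta] times [X] whatever [s] is, while [k] blows up as [s]
    tends to 1. *)
Lemma ncball_ttri_scale n (X : nctuple R d n) : ncball Q X ->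
  exists2 eta : R, 0 < eta & forall s : R, 0 < s < 1 ->
    ncball Q (ttri X (tscale s%:C%C X) (eta / (1 - s))%:C%C%:M).
Proof.
move=> /(ncballP Q_bounded)[r [r0 r1 hr]].
(* Then [r * (1 + eta) = 1 - eta ^+ 2 < 1] bounds the triangular tuple. *)
exists (1 - r); first by rewrite subr_gt0.
move=> s /andP[s0 s1]; set eta := 1 - r.
have eta0 : 0 < eta by rewrite subr_gt0.
have r'0 : 0 <= r * (1 + eta) by rewrite mulr_ge0// addr_ge0 ?ltW.
have r'1 : r * (1 + eta) < 1.
  have : 0 < eta * eta by rewrite mulr_gt0.
  by rewrite /eta; nra.
apply: (ncballI r'0 r'1) => v.
have -> : ttri X (tscale s%:C%C X) (eta / (1 - s))%:C%C%:M =
    fun j => block_mx (X j) (eta%:C%C *: X j) 0 (s%:C%C *: X j).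
  apply/funext => j; rewrite /ttri.
  apply: (f_equal (fun B => @block_mx C n.+1 n.+1 n.+1 n.+1 (X j) B 0 (s%:C%C *: X j))).
  rewrite mul_mx_scalar mul_scalar_mx scalerA -scalerBl; congr (_ *: _).
  rewrite -rmorphM -rmorphB -[X in X - _]mulr1 -mulrBr divfK//.
  by rewrite gt_eqF// subr_gt0.
pose v1 : 'I_n.+1 -> H := v \o @lshift n.+1 n.+1.
pose v2 : 'I_n.+1 -> H := v \o @rshift n.+1 n.+1.
rewrite pencilE (sqr_l2norm_rpencil_block Q X
  (fun j => eta%:C%C *: X j) (fun=> 0) (fun j => s%:C%C *: X j)).
rewrite !l2norm_rpencilD0 (@sqr_l2norm_split _ _ n.+1 n.+1 v) -/v1 -/v2.
rewrite (eq_l2norm (rpencilZ _ _ _ _)) l2normZ rnormC ?(ltW s0)//.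
rewrite (eq_l2norm (v := rpencil Q X (fun i => v1 i + eta%:C%C *: v2 i))) =>
  [|i]; last first.
  by rewrite rpencilZ rpencil_linear.
apply: le_trans (lerD (hr _) (lexx _)) _; rewrite !exprMn.
have h2 := hr v2; rewrite pencilE in h2.
have h1 : l2norm (fun i => v1 i + eta%:C%C *: v2 i) <= l2norm v1 + eta * l2norm v2.
  by rewrite (le_trans (ler_l2normD _ _))// l2normZ rnormC ?(ltW eta0).
set a := l2norm v1 in h1 *; set b := l2norm v2 in h1 h2 *.
have {}h1 : l2norm (fun i => v1 i + eta%:C%C *: v2 i) ^+ 2 <= (a + eta * b) ^+ 2.
  by apply: lerXn2r h1; rewrite nnegrE ?addr_ge0 ?mulr_ge0 ?l2norm_ge0// ltW.
have h3 : (a + eta * b) ^+ 2 + s ^+ 2 * b ^+ 2 <= (1 + eta) ^+ 2 * (a ^+ 2 + b ^+ 2).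
  rewrite -subr_ge0.
  have -> : (1 + eta) ^+ 2 * (a ^+ 2 + b ^+ 2) - ((a + eta * b) ^+ 2 + s ^+ 2 * b ^+ 2)
    = eta * (a - b) ^+ 2 + eta * a ^+ 2 + (eta * a) ^+ 2 +
      (eta + (1 - s ^+ 2)) * b ^+ 2 by ring.
  have e0 := ltW eta0.
  have s2 : 0 <= 1 - s ^+ 2 by rewrite subr_ge0 expr_le1 ?ltW.
  have p1 := mulr_ge0 e0 (sqr_ge0 (a - b)).
  have p2 := mulr_ge0 e0 (sqr_ge0 a).
  have p3 := mulr_ge0 (addr_ge0 e0 s2) (sqr_ge0 b).
  exact: addr_ge0 (addr_ge0 (addr_ge0 p1 p2) (sqr_ge0 _)) p3.
have h4 : s ^+ 2 * l2norm (rpencil Q X v2) ^+ 2 <= s ^+ 2 * (r ^+ 2 * b ^+ 2).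
  by rewrite ler_wpM2l ?sqr_ge0.
have h5 := ler_wpM2l (sqr_ge0 r) h1; have h6 := ler_wpM2l (sqr_ge0 r) h3.
move: h4 h5 h6; rewrite mulrDr [s ^+ 2 * (_ * _)]mulrCA mulrA; lra.
Qed.

Lemma subvariety_ncball (V : ncset R d) n (X : nctuple R d n) :
  subvariety Q V -> V n X -> ncball Q X.
Proof. by move=> [S _ ->] []. Qed.

Lemma subvariety_ttri (V : ncset R d) n m (X : nctuple R d n) (Y : nctuple R d m) k :
  subvariety Q V -> V n X -> V m Y -> ncball Q (ttri X Y k) -> V _ (ttri X Y k).
Proof.
move=> [S SH VE] VX VY bZ; rewrite VE; split=> // g Sg.
move: VX VY; rewrite !VE => -[bX X0] [bY Y0].
rewrite (nc_ttri (proj1 (SH _ Sg)) bX bY bZ) X0// Y0// mul0mx mulmx0 subrr.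
exact: (@block_mx0 _ n.+1 m.+1 n.+1 m.+1).
Qed.

(** Scaling by 0 gives the zero tuple at level [n]. Every matrix intertwines zero tuples, so matrix
    units carry the vanishing to all levels. *)
Lemma subvariety_zero (V : ncset R d) n (X : nctuple R d n) k :
  subvariety Q V -> homogeneous V -> V n X -> V k (fun=> 0).
Proof.
move=> [S SH VE] Vhom VX; rewrite VE; split=> [|g Sg]; first exact: ncball0.
have := Vhom 0 _ _ _ VX; rewrite normr0 ler01 => /(_ isT).
have -> : tscale 0 X = fun=> 0 by apply/funext => j; rewrite /tscale scale0r.
rewrite VE => -[b0 g0].
apply/matrixP => i j; rewrite mxE.
have := @nc_intertwine _ _ _ g k n (fun=> 0) (fun=> 0) (delta_mx j ord0)
  (proj1 (SH _ Sg)) (ncball0 Q k) b0.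
move=> /(_ (fun j => etrans (mul0mx _ _) (esym (mulmx0 _ _)))).
rewrite g0// mulmx0 => /matrixP/(_ i ord0).
by rewrite !mxE (bigD1 j)//= mxE !eqxx mulr1 big1 ?addr0// => l lj;
  rewrite mxE (negPf lj) mulr0.
Qed.

(** Boundedness at the amplified triangular tuple, divided by the factor (1 - t) / t^(m+1). It
    serves both for the defining functions on the ball and for [f] on the subvariety. *)
Lemma tnilp_corner (V : ncset R d) (f : ncmap R d) n (X : nctuple R d n) m p
    (P : 'M[C]_(p, (nilp_size n m).+1)) (M t : R) :
  0 < t < 1 -> nc_function V f -> 0 <= M ->
  (forall n (X : nctuple R d n), V n X -> opbound (f n X) M) ->
  V _ (tnilp X m) -> V _ (tscale t%:C%C X) ->
  V _ (ttri (tnilp X m) (tscale t%:C%C X) (geom_intertwiner n m t)) ->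
  opbound P 1 ->
  opbound (P *m (f _ (tnilp X m) *m geom_col n t%:C%C m -
                 geom_col n t%:C%C m *m f _ (tscale t%:C%C X)))
    (M * t ^+ m.+1 / (1 - t)).
Proof.
move=> /andP[t0 t1] f_nc M0 hM VY VtX VZ hP.
have := hM _ _ VZ; rewrite (nc_ttri f_nc VY VtX VZ).
move=> /(@opbound_corner _ (nilp_size n m).+1 n.+1 _ _ _ _ P _ M0)/(_ hP).
rewrite /geom_intertwiner -scalemxAr -scalemxAl -scalerBr -scalemxAr.
move=> /(opboundZ (- (t ^+ m.+1 / (1 - t))%:C%C)).
rewrite scalerA mulrNN -rmorphM.
rewrite mulrA divfK ?gt_eqF ?subr_gt0// divff ?gt_eqF ?exprn_gt0// scale1r.
have -> : rnorm (- (t ^+ m.+1 / (1 - t))%:C%C : C^o) = t ^+ m.+1 / (1 - t).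
  have -> : rnorm (- (t ^+ m.+1 / (1 - t))%:C%C : C^o) =
    rnorm ((t ^+ m.+1 / (1 - t))%:C%C : C^o) by rewrite /rnorm normrN.
  by rewrite rnormC// divr_ge0 ?exprn_ge0 ?subr_ge0 ?ltW.
by rewrite mulrC mulrA.
Qed.

(** A defining function [g] vanishes at every t X, so its value at the nilpotent point, paired with
    the geometric column, is O(t^(m+1)); [geom_col_eq0] concludes. *)
Lemma subvariety_tnilp (V : ncset R d) n (X : nctuple R d n) m :
  subvariety Q V -> homogeneous V -> V n X -> V _ (tnilp X m).
Proof.
move=> sV Vhom VX; have bX := subvariety_ncball sV VX.
case: (sV) => S SH VE; rewrite VE; split=> [|g Sg]; first exact: ncball_tnilp.
have [M M0 hM] := Hinfty_bounded (SH _ Sg).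
(* The factor 2 absorbs 1 / (1 - t) for t <= 1/2. *)
apply: (@geom_col_eq0 R n m _ _ (2 * M)) => [|t /andP[t0 t12]]; first exact: mulr_ge0.
have t1 : t < 1 by apply: (le_lt_trans t12); rewrite invf_lt1 ?ltr1n.
have t01 : 0 <= t <= 1 by rewrite !ltW.
have VtX : V n (tscale t%:C%C X).
  by apply: Vhom => //; rewrite normr_rnorm rnormC ?(ltW t0)// lecR ltW.
have gX0 : g _ (tscale t%:C%C X) = 0 by move: VtX; rewrite VE => -[_]; apply.
have := @tnilp_corner (ncball Q) g n X m _ 1%:M M t.
rewrite t0 t1 gX0 mulmx0 subr0 mul1mx => /(_ isT (proj1 (SH _ Sg)) M0 hM).
move=> /(_ (ncball_tnilp _ bX) (ncball_scale t01 bX)).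
have tt : 0 < t < 1 by rewrite t0.
move=> /(_ (ncball_ttri_tnilp _ tt bX) (@opbound1 R _)).
apply: opbound_le; rewrite ler_pdivrMr ?subr_gt0//.
have -> : 2 * M * t ^+ m.+1 * (1 - t) = M * t ^+ m.+1 * (2 * (1 - t)) by ring.
by rewrite ler_peMr ?mulr_ge0 ?exprn_ge0 ?(ltW t0)//; lra.
Qed.

(** Radial uniform continuity only sees radii below 1; this reaches [X] itself. The constant depends
    on [X] through its distance to the boundary. *)
Lemma radial_limit (V : ncset R d) (f : ncmap R d) n (X : nctuple R d n) :
  subvariety Q V -> homogeneous V -> Hinfty V f -> V n X ->
  exists2 c : R, 0 <= c & forall s : R, 0 < s < 1 ->
    opbound (f _ X - f _ (tscale s%:C%C X)) (c * (1 - s)).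
Proof.
move=> sV Vhom Hf VX; have bX := subvariety_ncball sV VX.
have [M M0 hM] := Hinfty_bounded Hf.
have [eta eta0 hZ] := ncball_ttri_scale bX.
exists (M / eta) => [|s s01]; first by rewrite divr_ge0// ltW.
have /andP[s0 s1] := s01.
have VsX : V n (tscale s%:C%C X).
  by apply: Vhom => //; rewrite normr_rnorm rnormC ?(ltW s0)// lecR ltW.
have VZ := subvariety_ttri sV VX VsX (hZ s s01).
have := hM _ _ VZ; rewrite (nc_ttri (proj1 Hf) VX VsX VZ).
move=> /(@opbound_corner _ n.+1 n.+1 _ _ _ _ 1%:M _ M0)/(_ (@opbound1 R _)).
rewrite mul1mx mul_mx_scalar mul_scalar_mx -scalerBr.
move=> /(opboundZ ((1 - s) / eta)%:C%C).
rewrite scalerA -rmorphM mulrA divfK ?gt_eqF// divff ?gt_eqF ?subr_gt0// scale1r.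
rewrite rnormC ?divr_ge0 ?subr_ge0 ?(ltW s1) ?(ltW eta0)//.
by apply: opbound_le; rewrite le_eqVlt; apply/orP; left; apply/eqP; ring.
Qed.

End Subvariety.

(** * Polynomial approximation *)

(** A subspace given as a set is the kernel of an idempotent. A matrix of maximal rank among those
    with rows in [I] has [I] as row space. *)
Lemma linear_setP (F : fieldType) N (I : set 'rV[F]_N) :
  I 0 -> (forall u v, I u -> I v -> I (u + v)) -> (forall a u, I u -> I (a *: u)) ->
  exists P : 'M[F]_N, (forall u, I u -> u *m P = 0) /\ forall i, I (row i (1%:M - P)).
Proof.
move=> I0 ID IZ.
have Isum m (u : 'rV_m) (A : 'M[F]_(m, N)) : (forall i, I (row i A)) -> I (u *m A).
  move=> IA; rewrite mulmx_sum_row; elim/big_rec : _ => // i x _ Ix.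
  by apply: ID => //; apply: IZ.
pose rk k := `[< exists A : 'M[F]_N, (forall i, I (row i A)) /\ \rank A = k >].
have rk0 : exists k : nat, rk k.
  by exists 0; apply/asboolP; exists 0; split; [move=> i; rewrite row0|exact: mxrank0].
have rkN k : rk k -> (k <= N)%N by move=> /asboolP[A [_ <-]]; exact: rank_leq_row.
have [k /asboolP[A [IA rA]] maxk] := ex_maxnP rk0 rkN.
have IAP u : I u -> (u <= A)%MS.
  move=> Iu; apply/negP => uA.
  have : (\rank A < \rank (A + u)%MS)%N.
    apply: rank_ltmx; rewrite /ltmx addsmxSl /=; apply/negP => h; case: uA.
    by rewrite (submx_trans (addsmxSr A u)).
  rewrite rA ltnNge maxk//; apply/asboolP; exists (A + u)%MS; split=> // i.
  have /sub_addsmxP[[x y] /= ->] : (row i (A + u)%MS <= (A + u)%MS)%MS by exact: row_sub.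
  apply: ID; apply: Isum => // j.
  by have -> : row j u = u by apply/rowP => l; rewrite mxE (ord1 j).
(* [pinvmx A *m A] is a projection onto the row space of [A]. *)
exists (1%:M - pinvmx A *m A); split=> [u /IAP uA|i].
  by rewrite mulmxBr mulmx1 mulmxA mulmxKpV// subrr.
by rewrite opprB addrC subrK row_mul; exact: Isum.
Qed.

(** Indices are in ['I_k.+1] since the empty word always occurs, as matrix levels require; [ix] is
    only specified on words of length at most [m]. *)
Lemma words_enum (d m : nat) :
  exists (k : nat) (e : 'I_k.+1 -> seq 'I_d) (ix : seq 'I_d -> 'I_k.+1),
  (forall w, (size w <= m)%N -> e (ix w) = w) /\ forall i, (size (e i) <= m)%N.
Proof.
pose T : finType := m.-bseq 'I_d.
have /prednK kE : (0 < #|T|)%N by apply/card_gt0P; exists [bseq].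
exists #|T|.-1, (fun i => val (enum_val (cast_ord kE i) : T)).
exists (fun w => cast_ord (esym kE) (enum_rank (insub_bseq m w : T))).
split=> [w wm|i]; last exact: size_bseq.
by rewrite cast_ordKV enum_rankK /insub_bseq insubdK.
Qed.

Section PolynomialOnNilpotents.
Variables (R : realType) (H K : hilbertType R) (d : nat).
Variable Q : 'I_d -> {linear H -> K}.
Hypothesis Q_bounded : forall j, continuous (Q j).
Local Notation C := R[i].

(** The orbit map sending a combination of words to [v] times its value at [Y]. *)
Definition word_orbit k (e : 'I_k.+1 -> seq 'I_d) n (Y : nctuple R d n)
    (v : 'rV[C]_n.+1) : 'M[C]_(k.+1, n.+1) :=
  \matrix_(i < k.+1) (v *m tword Y (e i)).

Lemma mul_word_orbit k (e : 'I_k.+1 -> seq 'I_d) n (Y : nctuple R d n) v c :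
  c *m word_orbit e Y v = v *m \sum_i c 0 i *: tword Y (e i).
Proof.
rewrite mulmx_sum_row mulmx_sumr; apply: eq_bigr => i _.
by rewrite rowK scalemxAr.
Qed.

Lemma mulmx_rows_inj n (A B : 'M[C]_n) : (forall v : 'rV_n, v *m A = v *m B) -> A = B.
Proof. by move=> h; apply/row_matrixP => i; rewrite !rowE h. Qed.

(* Let [E] be the span of the words of length at most [m], as functions on the
   nilpotent points of order [m.+1] of [V]; it is presented as the quotient of
   the row space on words by the relations, the kernel of the idempotent [P].
   Right multiplication by the coordinates is an operator tuple [N] on [E], a
   multiple of which lies in [V], as every [Y] is a quotient of [N] through the
   orbit maps [word_orbit]. Then [f] at [N], applied to the empty word, is the
   polynomial. *)
Lemma polynomial_on_nilpotents (V : ncset R d) (f : ncmap R d) m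
    n0 (X0 : nctuple R d n0) :
  subvariety Q V -> homogeneous V -> nc_function V f -> V n0 X0 ->
  exists (t : R) (k : nat) (e : 'I_k.+1 -> seq 'I_d) (c : 'I_k.+1 -> C),
    [/\ 0 < t <= 1, forall i, (size (e i) <= m)%N &
    forall n (Y : nctuple R d n), V n Y ->
      (forall w, (m < size w)%N -> tword Y w = 0) ->
      f n (tscale t%:C%C Y) = \sum_i c i *: tword Y (e i)].
Proof.
move=> sV Vhom f_nc VX0; have V0 k := subvariety_zero k sV Vhom VX0.
have [k [e [ix [eix em]]]] := words_enum d m.
pose nilp n (Y : nctuple R d n) := forall w, (m < size w)%N -> tword Y w = 0.
pose I : set 'rV[C]_k.+1 := [set c | forall n (Y : nctuple R d n), V n Y -> nilp n Y ->
  \sum_i c 0 i *: tword Y (e i) = 0].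
have [P [IP IQ]] : exists P : 'M[C]_k.+1,
    (forall c, I c -> c *m P = 0) /\ forall i, I (row i (1%:M - P)).
  apply: linear_setP => [n Y VY nY|u v Iu Iv n Y VY nY|a u Iu n Y VY nY].
  - by rewrite big1// => i _; rewrite mxE scale0r.
  - transitivity (\sum_i u 0 i *: tword Y (e i) + \sum_i v 0 i *: tword Y (e i)).
      by rewrite -big_split/=; apply: eq_bigr => i _; rewrite mxE scalerDl.
    by rewrite Iu// Iv// addr0.
  - transitivity (a *: \sum_i u 0 i *: tword Y (e i)).
      by rewrite scaler_sumr; apply: eq_bigr => i _; rewrite mxE scalerA.
    by rewrite Iu// scaler0.
have orbit_I c : (forall n (Y : nctuple R d n) v, V n Y -> nilp n Y ->
    c *m word_orbit e Y v = 0) -> I c.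
  move=> hc n Y VY nY; apply: mulmx_rows_inj => v.
  by rewrite -mul_word_orbit hc// mulmx0.
have I_orbit c n (Y : nctuple R d n) v : V n Y -> nilp n Y -> I c ->
    c *m word_orbit e Y v = 0.
  by move=> VY nY Ic; rewrite mul_word_orbit Ic// mulmx0.
have P_orbit n (Y : nctuple R d n) v : V n Y -> nilp n Y ->
    P *m word_orbit e Y v = word_orbit e Y v.
  move=> VY nY; apply/esym/eqP; rewrite -subr_eq0 -{1}[word_orbit e Y v]mul1mx.
  rewrite -mulmxBl; apply/eqP/row_matrixP => i; rewrite row_mul row0.
  exact: I_orbit.
have P_idem : P *m (1%:M - P) = 0.
  have : (1%:M - P) *m P = 0.
    by apply/row_matrixP => i; rewrite row_mul row0 IP.
  by rewrite mulmxBl mulmxBr mulmx1 mul1mx.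
(* Appending a letter, with words of length [m] sent to 0; the factor [P] then passes to the
   quotient by the relations. *)
pose N0 j : 'M[C]_k.+1 := \matrix_(i < k.+1)
  (if (size (e i) < m)%N then delta_mx 0 (ix (rcons (e i) j)) else 0).
pose N : nctuple R d k := fun j => N0 j *m P.
have N_orbit n (Y : nctuple R d n) v j : V n Y -> nilp n Y ->
    N j *m word_orbit e Y v = word_orbit e Y v *m Y j.
  move=> VY nY; rewrite -mulmxA P_orbit//; apply/row_matrixP => i.
  rewrite !row_mul !rowK -mulmxA -tword_rcons; case: ltnP => im.
    by rewrite -rowE rowK eix// size_rcons.
  by rewrite mul0mx nY ?mulmx0// size_rcons ltnS.
have [t /andP[t0 t1] bN] := ncball_absorbing Q_bounded N.
have V_scale n (Y : nctuple R d n) : V n Y -> V n (tscale t%:C%C Y).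
  by move=> VY; apply: Vhom => //; rewrite normr_rnorm rnormC ?(ltW t0)// lecR.
have VN : V k (tscale t%:C%C N).
  case: (sV) => S SH VE; rewrite VE; split=> // g Sg.
  have g_nc : nc_function (ncball Q) g := proj1 (SH _ Sg).
  have gV n (Y : nctuple R d n) : V n Y -> g n Y = 0.
    by rewrite VE => -[_]; exact.
  (* Orbit maps carry the rows of [g] at this point to values of [g] on [V], which are 0; so the
     rows are relations, killed by [P]. *)
  have gP : g k (tscale t%:C%C N) *m P = 0.
    apply/row_matrixP => i; rewrite row_mul row0; apply: IP.
    apply: orbit_I => n Y v VY nY; rewrite -row_mul.
    rewrite (nc_intertwine (Y := tscale t%:C%C Y) g_nc bN) ?gV ?mulmx0 ?row0//.
    - exact: V_scale.
    - exact: subvariety_ncball sV (V_scale _ _ VY).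
    - by move=> j; rewrite /tscale -scalemxAl -scalemxAr N_orbit.
  (* Since [N j *m (1%:M - P) = 0], the matrix [1%:M - P] intertwines with the zero tuple, where [g]
     vanishes. *)
  have gQ : g k (tscale t%:C%C N) *m (1%:M - P) = 0.
    rewrite (nc_intertwine (Y := fun=> 0) g_nc bN (ncball0 Q k)).
      by rewrite gV ?mulmx0.
    by move=> j; rewrite /tscale -scalemxAl -mulmxA P_idem !mulmx0 scaler0.
  by rewrite -[g _ _]mulmx1 -(subrK P 1%:M) mulmxDr gQ gP addr0.
(* The coefficients are the row of the empty word, whose orbit is [v] itself. *)
exists t, k, e, (fun i => f k (tscale t%:C%C N) (ix [::]) i); rewrite t0 t1.
split=> // n Y VY nY; apply: mulmx_rows_inj => v.
have /(congr1 (row (ix [::]))) :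
    f k (tscale t%:C%C N) *m word_orbit e Y v = word_orbit e Y v *m f n (tscale t%:C%C Y).
  apply: (nc_intertwine f_nc VN (V_scale _ _ VY)) => j.
  by rewrite /tscale -scalemxAl -scalemxAr N_orbit.
rewrite !row_mul rowK eix// /tword big_nil mulmx1 => <-.
rewrite mul_word_orbit; congr (_ *m _); apply: eq_bigr => i _.
by rewrite mxE.
Qed.

(** The polynomial is the first block row of [f] at the nilpotent point, paired with the geometric
    column; it does not depend on [X] or its size. *)
Lemma polynomial_approx (V : ncset R d) (f : ncmap R d) m
    n0 (X0 : nctuple R d n0) (M t : R) :
  subvariety Q V -> homogeneous V -> nc_function V f -> V n0 X0 -> 0 <= M ->
  (forall n (X : nctuple R d n), V n X -> opbound (f n X) M) ->
  0 < t < 1 ->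
  exists p : ncpoly R d, forall n (X : nctuple R d n), V n X ->
    opbound (f n (tscale t%:C%C X) - ncpoly_eval p X) (M * t ^+ m.+1 / (1 - t)).
Proof.
move=> sV Vhom f_nc VX0 M0 hM t01; have /andP[t0 t1] := t01.
have [l [k [e [c [/andP[l0 l1] em fE]]]]] := polynomial_on_nilpotents m sV Vhom f_nc VX0.
(* Only [f] at the dilate by [l] is known to be polynomial. [geom_diag] moves [l] out of [f],
   leaving the ratio [t / l]; it may exceed 1, which only affects coefficients. *)
pose s := (t / l)%:C%C : C.
exists [seq (c i * s ^+ size (e i), e i) | i <- index_enum 'I_k.+1] => n X VX.
have V_scale r n' (Y : nctuple R d n') : 0 < r <= 1 -> V n' Y -> V n' (tscale r%:C%C Y).
  move=> /andP[r0 r1] VY; apply: Vhom => //.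
  by rewrite normr_rnorm rnormC ?(ltW r0)// lecR.
have VY := subvariety_tnilp Q_bounded m sV Vhom VX.
have VtX : V n (tscale t%:C%C X) by apply: V_scale => //; rewrite t0 ltW.
have VlY : V _ (tscale l%:C%C (tnilp X m)) by apply: V_scale => //; rewrite l0.
have bX := subvariety_ncball sV VX.
have bZ := ncball_ttri_tnilp Q_bounded m t01 bX.
have := tnilp_corner t01 f_nc M0 hM VY VtX (subvariety_ttri sV VY VtX bZ)
  (@opbound_fst_block R n m).
rewrite mulmxBr !mulmxA fst_block_geom_col mul1mx => /opboundN; rewrite opprB.
suff -> : fst_block R n m *m f _ (tnilp X m) *m geom_col n t%:C%C m =
  ncpoly_eval [seq (c i * s ^+ size (e i), e i) | i <- index_enum 'I_k.+1] X by [].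
have -> : geom_col n t%:C%C m = geom_diag n l%:C%C m *m geom_col n s m.
  by rewrite geom_diag_col -rmorphM mulrC divfK// gt_eqF.
have fD : f _ (tnilp X m) *m geom_diag n l%:C%C m =
    geom_diag n l%:C%C m *m f _ (tscale l%:C%C (tnilp X m)).
  by apply: (nc_intertwine f_nc VY VlY) => j; rewrite tnilp_geom_diag.
rewrite mulmxA -[_ *m f _ _ *m _]mulmxA fD mulmxA fst_block_geom_diag.
rewrite fE//; last by move=> w; exact: tword_tnilp_eq0.
rewrite /ncpoly_eval big_map mulmx_sumr mulmx_suml; apply: eq_bigr => i _ /=.
by rewrite -scalemxAr -scalemxAl fst_block_tword_geom_col// scalerA.
Qed.

End PolynomialOnNilpotents.

(** * Boundedness of the ball and uniform continuity *)

Section BallBounded.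
Variables (R : realType) (H K : hilbertType R) (d : nat).
Variable Q : 'I_d -> {linear H -> K}.
Hypothesis Q_indep : lin_independent Q.
Local Notation C := R[i].

Lemma sqr_rnorm (U : hilbertType R) (x : U) : (rnorm x ^+ 2)%:C%C = inner x x.
Proof. by rewrite rmorphXn/= -normr_rnorm normr_inner. Qed.

(** Cauchy-Schwarz: expand the squared norm of [x] minus its projection on [y]. *)
Lemma ler_rnorm_inner (U : hilbertType R) (x y : U) :
  rnorm (inner x y : C^o) <= rnorm x * rnorm y.
Proof.
have [->|y0] := eqVneq y 0; first by rewrite linear0r !rnorm0 mulr0.
have {}y0 : 0 < rnorm y.
  by rewrite lt_neqAle rnorm_ge0 andbT eq_sym; apply: contra y0 => /eqP/rnorm_eq0 ->.
set b : C := inner x y.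
pose s : R := (rnorm y ^+ 2)^-1.
have h : (rnorm (x - (s%:C%C * b) *: y) ^+ 2)%:C%C =
   (rnorm x ^+ 2 + s ^+ 2 * rnorm (b : C^o) ^+ 2 * rnorm y ^+ 2
     - 2 * s * rnorm (b : C^o) ^+ 2)%:C%C.
  rewrite sqr_rnorm dnormB dnormZ linearZr_LR/= -/b -!sqr_rnorm.
  have creal (k : R) : Num.conj (k%:C%C : C) = k%:C%C.
    by apply: conj_Creal; apply/complex_realP; exists k.
  have conjM (u v : C) : Num.conj (u * v) = Num.conj u * Num.conj v by rewrite rmorphM.
  have e : Num.conj (s%:C%C * b) * b = (s * rnorm (b : C^o) ^+ 2)%:C%C.
    rewrite conjM creal -mulrA -normCKC (normr_rnorm (b : C^o)).
    by rewrite -rmorphXn -rmorphM.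
  have e2 : `|s%:C%C * b| = (s * rnorm (b : C^o))%:C%C.
    rewrite normrM (normr_rnorm (b : C^o)) (normr_rnorm (s%:C%C : C^o)) rnormC.
      by rewrite rmorphM.
    by rewrite invr_ge0 sqr_ge0.
  rewrite e creal e2 -rmorphXn -!rmorphM -!rmorphD -rmorphB; congr (_%:C%C).
  by ring.
have {}h := complexI h.
have : 0 <= rnorm (x - (s%:C%C * b) *: y) ^+ 2 by exact: sqr_ge0.
rewrite h.
have -> : rnorm x ^+ 2 + s ^+ 2 * rnorm (b : C^o) ^+ 2 * rnorm y ^+ 2
   - 2 * s * rnorm (b : C^o) ^+ 2 =
   (rnorm x ^+ 2 * rnorm y ^+ 2 - rnorm (b : C^o) ^+ 2) / rnorm y ^+ 2.
  by rewrite /s; field; rewrite gt_eqF.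
rewrite pmulr_lge0 ?invr_gt0 ?exprn_gt0// subr_ge0 -exprMn => h2.
by rewrite -(@ler_pXn2r _ 2)// nnegrE ?mulr_ge0 ?rnorm_ge0.
Qed.

(** This matrix is the slice of Q(X) between x (x) C^n and y (x) C^n, and Q(X) is a contraction. *)
Lemma opbound_inner n (X : nctuple R d n) x y : ncball Q X -> 
  (forall j, continuous (Q j)) ->
  opbound (\sum_j inner (Q j x) y *: X j) (rnorm x * rnorm y).
Proof.
move=> bX Qb v; have [r [r0 r1 hr]] := ncballP Qb bX.
pose w k := v k *: x.
have wE : l2norm w = l2norm v * rnorm x by exact: l2norm_scaler.
have E i : mxact (\sum_j inner (Q j x) y *: X j) v i = inner (rpencil Q X w i) y.
  rewrite /rpencil /mxact linear_sumlz.
  under eq_bigr do rewrite summxE scaler_suml.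
  rewrite exchange_big; apply: eq_bigr => j _; rewrite linear_sumlz.
  apply: eq_bigr => k _; rewrite linearZl_LR /w linearZ linearZl_LR mxE /=.
  transitivity (inner (Q j x) y * X j i k * v k) => //.
  ring.
apply: (@le_trans _ _ (rnorm y * l2norm (pencil Q X w))).
  rewrite l2norm_homo ?rnorm_ge0// !sqr_l2norm mulr_sumr; apply: ler_sum => i _.
  rewrite -exprMn E; apply: lerXn2r; rewrite ?nnegrE ?mulr_ge0 ?rnorm_ge0//.
  by rewrite mulrC ler_rnorm_inner.
rewrite [rnorm x * _]mulrC -mulrA ler_wpM2l ?rnorm_ge0// [_ * l2norm v]mulrC -wE.
rewrite -[leRHS]mul1r l2norm_homo// expr1n mul1r. 
apply: le_trans (hr _) _; apply: ler_piMl; first exact: sqr_ge0.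
by rewrite expr_le1// ltW.
Qed.

Lemma ncball_bounded (Q_bounded : forall j, continuous (Q j)) :
  exists2 B : R, 0 <= B & forall n (X : nctuple R d n) j,
    ncball Q X -> opbound (X j) B.
Proof.
pose L : set 'rV[C]_d := [set r | exists2 c : R, 0 <= c &
  forall n (X : nctuple R d n), ncball Q X -> opbound (\sum_j r 0 j *: X j) c].
have [P [LP LQ]] : exists P : 'M[C]_d,
    (forall r, L r -> r *m P = 0) /\ forall i, L (row i (1%:M - P)).
  apply: linear_setP => [|u v [a a0 ha] [b b0 hb]|a u [b b0 hb]].
  - exists 0 => // n X _; rewrite big1 => [|j _]; first exact: opbound0.
    by rewrite mxE scale0r.
  - exists (a + b) => [|n X bX]; first exact: addr_ge0.
    rewrite (eq_bigr (fun j => u 0 j *: X j + v 0 j *: X j)) => [|j _].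
      by rewrite big_split; apply: opboundD; [exact: ha|exact: hb].
    by rewrite mxE scalerDl.
  - exists (rnorm (a : C^o) * b) => [|n X bX]; first by rewrite mulr_ge0 ?rnorm_ge0.
    rewrite (eq_bigr (fun j => a *: (u 0 j *: X j))) => [|j _].
      by rewrite -scaler_sumr; apply: opboundZ; exact: hb.
    by rewrite mxE scalerA.
have P0 : P = 0.
  apply/matrixP => i l; rewrite mxE; move: i.
  apply: Q_indep => x; apply: rnorm_eq0; apply/eqP; rewrite -sqrf_eq0.
  (* Column [l] of [P] annihilates the row of all [inner (Q j x) z]. For [z] the combination of the
     [Q j x] with that column as coefficients, this says that z has norm 0. *)
  set z := \sum_j _; apply/eqP; apply: complexI; rewrite sqr_rnorm.
  have /LP/matrixP/(_ 0 l) : L (\row_j inner (Q j x) z).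
    exists (rnorm x * rnorm z) => [|n X bX]; first by rewrite mulr_ge0 ?rnorm_ge0.
    rewrite (eq_bigr (fun j => inner (Q j x) z *: X j)) => [|j _].
      exact: opbound_inner.
    by rewrite mxE.
  rewrite !mxE => h; rewrite {1}/z linear_sumlz -[RHS]h; apply: eq_bigr => j _.
  by rewrite linearZl_LR mxE [LHS]mulrC.
have /choice[c hc] : forall j, exists c : R, 0 <= c /\
    forall n (X : nctuple R d n), ncball Q X -> opbound (X j) c.
  move=> j; have [c c0 hc] := LQ j; exists c; split=> // n X /hc.
  rewrite (bigD1 j)//= big1 ?addr0 => [|i ij].
    by rewrite P0 subr0 !mxE eqxx scale1r.
  by rewrite P0 subr0 !mxE eq_sym (negPf ij) scale0r.
exists (\sum_j c j) => [|n X j bX].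
  by apply: sumr_ge0 => j _; case: (hc j).
apply: opbound_le (proj2 (hc j) n X bX); rewrite (bigD1 j)//= lerDl.
by apply: sumr_ge0 => i _; case: (hc i).
Qed.

End BallBounded.

(** * Lipschitz estimates for words and polynomials, and the supremum norm *)

Section Continuity.
Variables (R : realType) (d : nat).
Local Notation C := R[i].

(** The difference telescopes one letter at a time, so a bound on the words is carried along in the
    induction. *)
Lemma tword_lipschitz (V : ncset R d) (B : R) w : 0 <= B ->
  (forall n (X : nctuple R d n) j, V n X -> opbound (X j) B) ->
  (exists2 b : R, 0 <= b & forall n (X : nctuple R d n), V n X ->
     opbound (tword X w) b) /\
  exists2 D : R, 0 <= D & forall n (X Y : nctuple R d n) e, 0 <= e ->
     V n X -> V n Y -> (forall j, opbound (X j - Y j) e) ->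
     opbound (tword X w - tword Y w) (D * e).
Proof.
move=> B0 hB; elim: w => [|j w [[b b0 hb] [D D0 hD]]].
  split; first by exists 1 => // n X _; rewrite /tword big_nil; exact: opbound1.
  exists 0 => // n X Y e e0 _ _ _; rewrite /tword !big_nil subrr mul0r.
  exact: opbound0.
split.
  exists (B * b) => [|n X VX]; first exact: mulr_ge0.
  by rewrite tword_cons; apply: opboundM (hb _ _ VX) => //; exact: hB.
exists (b + B * D) => [|n X Y e e0 VX VY XY]; first by rewrite addr_ge0 ?mulr_ge0.
have -> : tword X (j :: w) - tword Y (j :: w) =
    (X j - Y j) *m tword X w + Y j *m (tword X w - tword Y w).
  by rewrite !tword_cons mulmxBl mulmxBr addrA subrK.
rewrite mulrDl [b * e]mulrC -[B * D * e]mulrA; apply: opboundD.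
  by apply: opboundM (hb _ _ VX).
by apply: opboundM (hD _ _ _ _ e0 VX VY XY) => //; exact: hB.
Qed.

Lemma ncpoly_lipschitz (V : ncset R d) (B : R) (p : ncpoly R d) : 0 <= B ->
  (forall n (X : nctuple R d n) j, V n X -> opbound (X j) B) ->
  exists2 D : R, 0 <= D & forall n (X Y : nctuple R d n) e, 0 <= e ->
     V n X -> V n Y -> (forall j, opbound (X j - Y j) e) ->
     opbound (ncpoly_eval p X - ncpoly_eval p Y) (D * e).
Proof.
move=> B0 hB; elim: p => [|[a w] p [D D0 hD]].
  exists 0 => // n X Y e e0 _ _ _; rewrite /ncpoly_eval !big_nil subrr mul0r.
  exact: opbound0.
have [_ [E E0 hE]] := tword_lipschitz w B0 hB.
exists (rnorm (a : C^o) * E + D) => [|n X Y e e0 VX VY XY].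
  by rewrite addr_ge0 ?mulr_ge0 ?rnorm_ge0.
have -> : ncpoly_eval ((a, w) :: p) X - ncpoly_eval ((a, w) :: p) Y =
    a *: (tword X w - tword Y w) + (ncpoly_eval p X - ncpoly_eval p Y).
  by rewrite /ncpoly_eval !big_cons /= scalerBr opprD addrACA.
by rewrite mulrDl -mulrA; apply: opboundD; [apply: opboundZ; exact: hE|exact: hD].
Qed.

Lemma mxopnorm_le_tnorm n (X : nctuple R d n) j : mxopnorm (X j) <= tnorm X.
Proof. exact: (le_bigmax _ (fun j => mxopnorm (X j))). Qed.

Lemma supnorm_le (V : ncset R d) (f : ncmap R d) (c : R) : 0 <= c ->
  (forall n (X : nctuple R d n), V n X -> opbound (f n X) c) ->
  (supnorm V f <= c%:E)%E.
Proof.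
move=> c0 hf; apply: ge_ereal_sup => _ [n [X [VX ->]]].
by rewrite lee_fin; apply: mxopnorm_le => //; exact: hf.
Qed.

Lemma supnorm_lt (V : ncset R d) (f : ncmap R d) (c : R) :
  (supnorm V f < c%:E)%E ->
  forall n (X : nctuple R d n), V n X -> opbound (f n X) c.
Proof.
move=> fc n X VX; apply: opbound_le (opbound_mxopnorm _); rewrite -lee_fin.
by apply: le_trans (ltW fc); apply: ereal_sup_ubound; exists n, X.
Qed.

End Continuity.

(** * The three implications *)

Section Equivalence.
Variables (R : realType) (H K : hilbertType R) (d : nat).
Variable Q : 'I_d -> {linear H -> K}.
Hypothesis Q_bounded : forall j, continuous (Q j).
Hypothesis Q_indep : lin_independent Q.
Variables (V : ncset R d) (f : ncmap R d).
Hypotheses (V_subvariety : subvariety Q V) (V_hom : homogeneous V).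
Hypothesis f_Hinfty : Hinfty V f.

(** The chain is f(X), f(sX), f(tX), p(X), with steps of size at most e / 4. Here [t] and [p] are
    uniform while [s] depends on [X]. *)
Lemma radially_unif_continuous_Adisc :
  radially_unif_continuous_on V f -> Adisc V f.
Proof.
move=> f_rad; split=> // e e0.
(* The polynomial construction needs a point of [V]; on the empty set the zero polynomial does. *)
have [[n0 [X0 VX0]]|V0] := pselect (exists n0 (X0 : nctuple R d n0), V X0); last first.
  exists [::]; apply: le_lt_trans (_ : 0 < e%:E)%E; last by rewrite lte_fin.
  by apply: supnorm_le => // n X VX; case: V0; exists n, X.
have [M M0 hM] := Hinfty_bounded f_Hinfty.
have e4 : 0 < e / 4 by rewrite divr_gt0.
have [dl dl0 hdl] := f_rad _ e4.
(* Every [s] between [t] and 1 is then within [dl] of [t], and 1/2 keeps [t] positive. *)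
pose t : R := Num.max 2^-1 (1 - dl / 2).
have t12 : 2^-1 <= t by rewrite le_max lexx.
have t0 : 0 < t by rewrite (lt_le_trans _ t12)// invr_gt0.
have t1 : t < 1 by rewrite gt_max invf_lt1 ?ltr1n//= ltrBlDr ltrDl divr_gt0.
have td : 1 - t < dl.
  have : 1 - dl / 2 <= t by rewrite le_max lexx orbT.
  lra.
have t01 : 0 < t < 1 by rewrite t0.
have [m hm] : exists m : nat, M * t ^+ m.+1 / (1 - t) <= e / 4.
  have x0 : 0 < e / 4 * (1 - t) / (M + 1).
    by rewrite divr_gt0 ?mulr_gt0 ?subr_gt0// ltr_wpDl.
  have nt1 : `|t| < 1 by rewrite ger0_norm// ltW.
  have /cvgr0Pnorm_lt/(_ _ x0)[m _ /(_ m.+1 (leqnSn m))] := cvg_expr nt1.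
  rewrite /= ger0_norm ?exprn_ge0 ?(ltW t0)// ltr_pdivlMr ?ltr_wpDl// => h.
  exists m; rewrite ler_pdivrMr ?subr_gt0// mulrC (le_trans _ (ltW h))//.
  by rewrite ler_wpM2l ?exprn_ge0 ?(ltW t0)// lerDl.
have [p hp] := polynomial_approx Q_bounded m V_subvariety V_hom
  (proj1 f_Hinfty) VX0 M0 hM t01.
exists p; apply: (@le_lt_trans _ _ (3 * (e / 4))%:E); last by rewrite lte_fin; lra.
apply: supnorm_le => [|n X VX]; first by rewrite mulr_ge0// ltW.
have [c c0 hc] := radial_limit Q_bounded V_subvariety V_hom f_Hinfty VX.
have [s s01 [ts cs]] : exists2 s : R, 0 < s < 1 & t < s /\ c * (1 - s) <= e / 4.
  have c1 : 0 < c + 1 by rewrite ltr_wpDl.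
  pose u := e / 4 / (c + 1); have u0 : 0 < u by rewrite divr_gt0.
  have uE : c * u <= e / 4.
    by rewrite -[leRHS](divfK (lt0r_neq0 c1)) -/u mulrC ler_wpM2l ?(ltW u0)// lerDl.
  (* The first term puts [s] above [t], the second gives [1 - s <= u]. *)
  exists (Num.max ((1 + t) / 2) (1 - u)).
    rewrite lt_max gt_max; apply/andP; split; [apply/orP; left|apply/andP; split]; lra.
  split; first by rewrite lt_max; apply/orP; left; lra.
  apply: le_trans uE; apply: ler_wpM2l => //.
  have : 1 - u <= Num.max ((1 + t) / 2) (1 - u) by rewrite le_max lexx orbT.
  lra.
have /andP[s0 s1] := s01.
have -> : f X - ncpoly_eval p X = (f X - f (tscale s%:C%C X)) +
    ((f (tscale s%:C%C X) - f (tscale t%:C%C X)) +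
    (f (tscale t%:C%C X) - ncpoly_eval p X)).
  by rewrite !subrKA.
have -> : 3 * (e / 4) = e / 4 + (e / 4 + e / 4) by lra.
apply: opboundD; first exact: opbound_le (hc _ s01).
apply: opboundD; last exact: opbound_le (hp _ _ VX).
apply: opbound_le (opbound_mxopnorm _); apply: ltW; apply: hdl => //.
by rewrite ger0_norm; lra.
Qed.

Lemma Adisc_unif_continuous : Adisc V f -> unif_continuous_on V f.
Proof.
move=> [_ f_approx] e e0.
have [B B0 hB] := ncball_bounded Q_indep Q_bounded.
have hV n (X : nctuple R d n) j : V X -> opbound (X j) B.
  by move=> VX; apply: hB; exact: subvariety_ncball V_subvariety VX.
have e4 : 0 < e / 4 by rewrite divr_gt0.
have [p hp] := f_approx _ e4.
have [D D0 hD] := ncpoly_lipschitz p B0 hV.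
have D1 : 0 < D + 1 by rewrite ltr_wpDl.
exists (e / 4 / (D + 1)) => [|n X Y VX VY XY]; first by rewrite divr_gt0.
apply: (@le_lt_trans _ _ (3 * (e / 4))); last by lra.
apply: mxopnorm_le; first by rewrite mulr_ge0// ltW.
have -> : f X - f Y = (f X - ncpoly_eval p X) +
    ((ncpoly_eval p X - ncpoly_eval p Y) - (f Y - ncpoly_eval p Y)).
  by rewrite opprB !subrKA.
have -> : 3 * (e / 4) = e / 4 + (e / 4 + e / 4) by lra.
apply: opboundD; first exact: (supnorm_lt hp).
apply: opboundD; last by apply: opboundN; exact: (supnorm_lt hp).
have t0 : 0 <= tnorm (tsub X Y).
  rewrite /tnorm; elim/big_rec : _ => // i x _ x0.
  by rewrite le_max x0 orbT.
apply: (@opbound_le _ _ _ _ (D * tnorm (tsub X Y))).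
  move: XY; rewrite ltr_pdivlMr// => XY; apply: ltW; apply: le_lt_trans XY.
  by rewrite mulrC ler_wpM2l// lerDl.
apply: hD => // j; apply: opbound_le (opbound_mxopnorm _).
exact: mxopnorm_le_tnorm.
Qed.

(** The coordinates are bounded on the ball uniformly in the size, so close radii give uniformly
    close tuples. *)
Lemma unif_continuous_radially :
  unif_continuous_on V f -> radially_unif_continuous_on V f.
Proof.
move=> f_unif e e0; have [dl dl0 hdl] := f_unif _ e0.
have [B B0 hB] := ncball_bounded Q_indep Q_bounded.
have B1 : 0 < B + 1 by rewrite ltr_wpDl.
exists (dl / (B + 1)) => [|n X r s VX r01 s01]; first by rewrite divr_gt0.
rewrite ltr_pdivlMr// => rs.
have V_scale t : 0 < t < 1 -> V (tscale t%:C%C X).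
  move=> /andP[t0 t1]; apply: V_hom => //.
  by rewrite normr_rnorm rnormC ?(ltW t0)// lecR ltW.
apply: hdl; [exact: V_scale|exact: V_scale|].
rewrite /tnorm; apply: bigmax_lt => // j _.
apply: (@le_lt_trans _ _ (`|r - s| * B)); last first.
  by apply: le_lt_trans rs; rewrite ler_wpM2l// lerDl.
apply: mxopnorm_le; first exact: mulr_ge0.
rewrite /tsub /tscale -scalerBl -rmorphB.
have -> : `|r - s| = rnorm ((r - s)%:C%C : R[i]^o).
  by rewrite /rnorm normc_def/= expr0n addr0 sqrtr_sqr.
by apply: opboundZ; apply: hB; exact: subvariety_ncball V_subvariety VX.
Qed.

End Equivalence.

Theorem proposition4p12 (R : realType) (H K : hilbertType R) (d : nat)
    (Q : 'I_d -> {linear H -> K})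
    (Q_bounded : forall j, continuous (Q j))
    (Q_indep : lin_independent Q)
    (V : ncset R d) (V_subvariety : subvariety Q V) (V_hom : homogeneous V)
    (f : ncmap R d) (f_Hinfty : Hinfty V f) :
  [<-> radially_unif_continuous_on V f;
       Adisc V f;
       unif_continuous_on V f].
Proof.
tfae.
- exact: (radially_unif_continuous_Adisc Q_bounded V_subvariety V_hom f_Hinfty).
- exact: (Adisc_unif_continuous Q_bounded Q_indep V_subvariety).
- exact: (unif_continuous_radially Q_bounded Q_indep V_subvariety V_hom).
Qed.
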